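(* In the setting of the backward linear-quadratic problem (BLQ) described in the context, assume: (i) $M$ is positive definite; (ii) $Q_k(\omega)$ and $L_k(\omega)$ are nonnegative definite for every $(\omega,k)\in\Omega\times\mathbb T$; (iii) there is a constant $\delta>0$ such that $R_k(\omega)-\delta I_m\ge0$ for every $(\omega,k)\in\Omega\times\mathbb T$, where $I_m$ is the unit matrix. Let $\eta\in L^2_{\mathcal F_{N-1}}(\Omega;\mathbb R^n)$ be a given terminal state. Then the Hamiltonian system $$ \begin{cases} \bar x_{k+1}=A_k^\top\bar x_k-Q_k\bar y'_{k+1}+\big(B_k^\top\bar x_k-L_k\bar z'_{k+1}\big)w_k, & k\in\mathbb T,\\ \bar y_k=A_k\bar y'_{k+1}+B_k\bar z'_{k+1}+C_k\bar v_k+\alpha_k, & k\in\mathbb T,\\ \bar x_0=-M\bar y_0,\qquad \bar y_N=\eta,\\ 0=C_k^\top\bar x_k-R_k\bar v_k, & k\in\mathbb T, \end{cases} $$ where $\bar y'_{k+1}=\mathbb E[\bar y_{k+1}\mid\mathcal F_{k-1}]$ and $\bar z'_{k+1}=\mathbb E[\bar y_{k+1}w_k\mid\mathcal F_{k-1}]$, admits a unique solution $(\bar x(\cdot),\bar y(\cdot))\in N^2(\overline{\mathbb T};\mathbb R^{2n})$. Moreover, $$\bar v_k=R_k^{-1}C_k^\top\bar x_k,\qquad k\in\mathbb T,$$ is the unique optimal control of Problem (BLQ) for the terminal state $\eta$.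
   Context: **Probabilistic setting.** $N$ is a fixed positive integer, $\mathbb T=\{0,\dots,N-1\}$, $\overline{\mathbb T}=\{0,\dots,N\}$. On a complete probability space $(\Omega,\mathcal F,\mathbb P)$, $\{w_k\}_{k\in\mathbb T}$ is a real-valued martingale difference sequence with respect to the filtration $\mathcal F_k=\sigma(w_0,\dots,w_k)$, $k=0,\dots,N-1$, with $\mathcal F_{-1}=\{\emptyset,\Omega\}$ trivial: $\mathbb E[w_k\mid\mathcal F_{k-1}]=0$ and $\mathbb E[w_k^2\mid\mathcal F_{k-1}]=1$ for all $k\in\mathbb T$. **Spaces.** $\mathbb S^n$ is the set of symmetric $n\times n$ real matrices. For $\mathbb K\in\{\mathbb T,\overline{\mathbb T}\}$, $L^2_{\mathbb F}(\mathbb K;\mathbb H)$ (resp. $L^\infty_{\mathbb F}(\mathbb K;\mathbb H)$) is the set of $\mathbb H$-valued processes $(h_k)_{k\in\mathbb K}$ with $h_k$ being $\mathcal F_{k-1}$-measurable and $\mathbb E\sum_{k\in\mathbb K}\|h_k\|^2<\infty$ (resp. essentially bounded). $L^2_{\mathcal F_{N-1}}(\Omega;\mathbb R^n)$ is the set of square-integrable $\mathcal F_{N-1}$-measurable $\mathbb R^n$-valued random variables. $N^2(\overline{\mathbb T};\mathbb R^{2n})=L^2_{\mathbb F}(\overline{\mathbb T};\mathbb R^n)\times L^2_{\mathbb F}(\overline{\mathbb T};\mathbb R^n)$. The set of admissible controls is $\mathbb U=\{v=(v_0,\dots,v_{N-1}):v_k\in\mathbb R^m\text{ is }\mathcal F_{k-1}\text{-measurable},\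 \mathbb E\sum_{k=0}^{N-1}|v_k|^2<\infty\}$. **Problem (BLQ).** For $\eta\in L^2_{\mathcal F_{N-1}}(\Omega;\mathbb R^n)$ and $v(\cdot)\in\mathbb U$ let $y(\cdot)\in L^2_{\mathbb F}(\overline{\mathbb T};\mathbb R^n)$ be the unique solution of $$y_k=A_ky'_{k+1}+B_kz'_{k+1}+C_kv_k+\alpha_k,\quad k\in\mathbb T,\qquad y_N=\eta,$$ where $y'_{k+1}=\mathbb E[y_{k+1}\mid\mathcal F_{k-1}]$, $z'_{k+1}=\mathbb E[y_{k+1}w_k\mid\mathcal F_{k-1}]$, $A(\cdot),B(\cdot)\in L^\infty_{\mathbb F}(\mathbb T;\mathbb R^{n\times n})$, $C(\cdot)\in L^\infty_{\mathbb F}(\mathbb T;\mathbb R^{n\times m})$, $\alpha(\cdot)\in L^2_{\mathbb F}(\mathbb T;\mathbb R^n)$. The criterion is $$J(N;\eta,v(\cdot))=\tfrac12\mathbb E\Big\{\langle My_0,y_0\rangle+\sum_{k=0}^{N-1}\big[\langle Q_ky'_{k+1},y'_{k+1}\rangle+\langle L_kz'_{k+1},z'_{k+1}\rangle+\langle R_kv_k,v_k\rangle\big]\Big\},$$ with $M\in\mathbb S^n$, $Q(\cdot),L(\cdot)\in L^\infty_{\mathbb F}(\mathbb T;\mathbb S^n)$, $R(\cdot)\in L^\infty_{\mathbb F}(\mathbb T;\mathbb S^m)$. Problem (BLQ) is, for the given $\eta$, to find $\bar v(\cdot)\in\mathbb U$ with $J(N;\eta,\bar v(\cdot))=\inf_{v(\cdot)\in\mathbb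 U}J(N;\eta,v(\cdot))$; such $\bar v(\cdot)$ is called an optimal control. *)

(* Defs.v *)
From HB Require Import structures.
From mathcomp Require Import all_boot all_order all_algebra.
From mathcomp Require Import all_classical all_reals all_analysis.

Set Implicit Arguments.
Unset Strict Implicit.
Unset Printing Implicit Defensive.

Import Order.TTheory GRing.Theory Num.Theory.
Import numFieldNormedType.Exports.

Local Open Scope classical_set_scope.
Local Open Scope ring_scope.

Section LinearAlgebra.
Context {R : realType}.

Definition dotv {n} (u v : 'cV[R]_n) : R := \sum_(i < n) u i 0 * v i 0.

Definition psdmx {n} (A : 'M[R]_n) : Prop :=
  forall u : 'cV[R]_n, 0 <= dotv (A *m u) u.

Definition pdmx {n} (A : 'M[R]_n) : Prop :=
  forall u : 'cV[R]_n, u != 0 -> 0 < dotv (A *m u) u.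

End LinearAlgebra.

Section ConditionalExpectation.
Context {d : measure_display} {T : measurableType d} {R : realType}.
Variable P : probability T R.

(* In this section [G] stands for the sigma-algebra <<s G>> it generates. *)

Definition sub_measurable (G : set (set T)) (X : T -> R) : Prop :=
  measurable_fun [set: g_sigma_algebraType G] (X : g_sigma_algebraType G -> R).

(* [Y] is a version of E[X | G]; only meaningful when G is a family of events.
   Integrability of [X] is part of the definition. *)
Definition is_cexp (G : set (set T)) (X Y : T -> R) : Prop :=
  [/\ P.-integrable [set: T] (EFin \o X),
      sub_measurable G Y,
      P.-integrable [set: T] (EFin \o Y) &
      forall A : set T, <<s G >> A ->
        (\int[P]_(x in A) (Y x)%:E = \int[P]_(x in A) (X x)%:E)%E].

(* A chosen version of E[X | G]; the default value 0 is only taken when there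
   is no version at all, e.g. when [X] is not integrable. *)
Definition cexp (G : set (set T)) (X : T -> R) : T -> R :=
  xget (fun=> 0) [set Y | is_cexp G X Y].

Definition cexpv (G : set (set T)) {n} (X : T -> 'cV[R]_n) : T -> 'cV[R]_n :=
  fun x => \col_(i < n) cexp G (fun t => X t i 0) x.

End ConditionalExpectation.

(* Processes are indexed by nat; only the indices k < N, or k <= N for those
   living on {0, ..., N}, are ever constrained. *)
Section Spaces.
Context {d : measure_display} {T : measurableType d} {R : realType}.
Variables (P : probability T R) (w : nat -> T -> R).

(* [past k] = sigma(w_0, ..., w_(k-1)), i.e. F_(k-1) in the convention
   F_k = sigma(w_0, ..., w_k); in particular [past 0] is trivial. *)
Definition past (k : nat) : set (set T) :=
  g_sigma_preimage (fun i : 'I_k => w i).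

Definition martingale_difference (N : nat) : Prop :=
  forall k, (k < N)%N ->
    is_cexp P (past k) (w k) (fun=> 0) /\
    is_cexp P (past k) (fun t => w k t ^+ 2) (fun=> 1).

Definition adapted {p q : nat} (K : nat) (h : nat -> T -> 'M[R]_(p, q)) : Prop :=
  forall k, (k < K)%N ->
    forall i j, sub_measurable (past k) (fun t => h k t i j).

(* L^2_F({0, ..., K-1}; R^p), with h_k being F_(k-1)-measurable *)
Definition L2F {p : nat} (K : nat) (h : nat -> T -> 'cV[R]_p) : Prop :=
  adapted K h /\
  ('E_P[fun t => (\sum_(k < K) dotv (h k t) (h k t))%R] < +oo)%E.

(* L^oo_F({0, ..., K-1}; R^(p x q)) *)
Definition LinfF {p q : nat} (K : nat) (h : nat -> T -> 'M[R]_(p, q)) : Prop :=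
  adapted K h /\
  exists c : R, forall k, (k < K)%N -> \forall t \ae P, mx_norm (h k t) <= c.

(* L^oo_F({0, ..., K-1}; S^p) *)
Definition LinfF_sym {p : nat} (K : nat) (h : nat -> T -> 'M[R]_p) : Prop :=
  LinfF K h /\ forall k t, (k < K)%N -> h k t \is symmetricmx.

(* square-integrable and F_(K-1)-measurable *)
Definition L2rv {p : nat} (K : nat) (X : T -> 'cV[R]_p) : Prop :=
  (forall i, sub_measurable (past K) (fun t => X t i 0)) /\
  ('E_P[fun t => dotv (X t) (X t)] < +oo)%E.

(* equality on {0, ..., K-1}, almost surely *)
Definition eq_process {V : Type} (K : nat) (h h' : nat -> T -> V) : Prop :=
  forall k, (k < K)%N -> \forall t \ae P, h k t = h' k t.

(* y'_(k+1) and z'_(k+1) *)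
Definition yprime {p : nat} (y : nat -> T -> 'cV[R]_p) (k : nat) :
    T -> 'cV[R]_p :=
  cexpv P (past k) (y k.+1).

Definition zprime {p : nat} (y : nat -> T -> 'cV[R]_p) (k : nat) :
    T -> 'cV[R]_p :=
  cexpv P (past k) (fun t => w k t *: y k.+1 t).

End Spaces.

(* The data A, B, C, alpha of the state equation, and the weights M, Q, L, R
   of the criterion. *)
Record blq_data (R : realType) (T : Type) (n m : nat) := BLQData {
  dA : nat -> T -> 'M[R]_n;
  dB : nat -> T -> 'M[R]_n;
  dC : nat -> T -> 'M[R]_(n, m);
  dalpha : nat -> T -> 'cV[R]_n;
  dM : 'M[R]_n;
  dQ : nat -> T -> 'M[R]_n;
  dL : nat -> T -> 'M[R]_n;
  dR : nat -> T -> 'M[R]_m }.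

Section BLQ.
Context {d : measure_display} {T : measurableType d} {R : realType}.
Variables (P : probability T R) (w : nat -> T -> R) (N : nat).
Context {n m : nat}.
Variable D : blq_data R T n m.

Local Notation yp := (yprime P w).
Local Notation zp := (zprime P w).

Definition blq_regular : Prop :=
  [/\ LinfF P w N (dA D), LinfF P w N (dB D), LinfF P w N (dC D) &
      L2F P w N (dalpha D)] /\
  [/\ dM D \is symmetricmx, LinfF_sym P w N (dQ D),
      LinfF_sym P w N (dL D) & LinfF_sym P w N (dR D)].

Definition admissible : set (nat -> T -> 'cV[R]_m) := [set v | L2F P w N v].

Definition state_equation (v : nat -> T -> 'cV[R]_m)
    (y : nat -> T -> 'cV[R]_n) : Prop :=
  forall k, (k < N)%N -> \forall t \ae P,
    y k t = dA D k t *m yp y k t + dB D k t *m zp y k t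
            + dC D k t *m v k t + dalpha D k t.

Definition is_state (eta : T -> 'cV[R]_n) (v : nat -> T -> 'cV[R]_m)
    (y : nat -> T -> 'cV[R]_n) : Prop :=
  [/\ L2F P w N.+1 y, state_equation v y & \forall t \ae P, y N t = eta t].

(* For [v] admissible this is the solution of the state equation, which is
   unique up to almost sure equality. *)
Definition state (eta : T -> 'cV[R]_n) (v : nat -> T -> 'cV[R]_m) :
    nat -> T -> 'cV[R]_n :=
  xget (fun _ _ => 0) [set y | is_state eta v y].

Definition cost (eta : T -> 'cV[R]_n) (v : nat -> T -> 'cV[R]_m) : \bar R :=
  let y := state eta v in
  ((2^-1)%:E * 'E_P[fun t => (dotv (dM D *m y 0 t) (y 0 t) +
    \sum_(k < N) (dotv (dQ D k t *m yp y k t) (yp y k t)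
                  + dotv (dL D k t *m zp y k t) (zp y k t)
                  + dotv (dR D k t *m v k t) (v k t)))%R])%E.

Definition optimal_control (eta : T -> 'cV[R]_n)
    (v : nat -> T -> 'cV[R]_m) : Prop :=
  admissible v /\ cost eta v = ereal_inf [set cost eta u | u in admissible].

(* The equations of the Hamiltonian system, without integrability conditions
   on the unknowns. *)
Definition hamiltonian_system (eta : T -> 'cV[R]_n)
    (x y : nat -> T -> 'cV[R]_n) (v : nat -> T -> 'cV[R]_m) : Prop :=
  [/\ forall k, (k < N)%N -> \forall t \ae P,
        x k.+1 t = (dA D k t)^T *m x k t - dQ D k t *m yp y k t
          + w k t *: ((dB D k t)^T *m x k t - dL D k t *m zp y k t),
      state_equation v y,
      \forall t \ae P, x 0 t = - (dM D *m y 0 t),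
      \forall t \ae P, y N t = eta t &
      forall k, (k < N)%N -> \forall t \ae P,
        0 = (dC D k t)^T *m x k t - dR D k t *m v k t].

End BLQ.

(* Main.v *)
Require Import Defs.
From HB Require Import structures.
From mathcomp Require Import all_boot all_order all_algebra.
From mathcomp Require Import all_classical all_reals all_analysis.
From mathcomp Require Import measurable_realfun lra ring.

Set Implicit Arguments.
Unset Strict Implicit.
Unset Printing Implicit Defensive.

Import Order.TTheory GRing.Theory Num.Theory.
Import numFieldNormedType.Exports.

Local Open Scope classical_set_scope.
Local Open Scope ring_scope.

(** The Hamiltonian system says that the gradient of the cost vanishes. For a
    control [v], let [y] be its state and let [x] solve the forward equation of
    the system driven by [y]. Since [y'] and [z'] are adjoint to the inclusion
    of [L^2(F_(k-1))] and to multiplication by [w_k], summation by parts along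
    the two equations ([duality]) identifies the process [R v - C^T x] with the
    gradient of the cost at [v] ([gradient_cost_form]). So the solutions of the
    system are exactly the stationary controls with their states and adjoints.

    The cost is a quadratic function of [v] whose second-order part dominates
    [delta * E sum `|v_k|^2] ([cost_form_ge]), because [M], [Q] and [L] are
    nonnegative. Hence the gradient is strongly monotone
    ([gradient_monotone]); it is also Lipschitz, because conditional
    expectations contract [L^2] norms and the coefficients are bounded
    ([linear_state_le], [adjoint_le], [gradient_le]). A short gradient step is
    then a contraction of the space of controls, which is complete
    ([contraction_fixpoint]), and its fixed point is a stationary control
    ([stationary_control_exists]). Strong monotonicity makes this control
    unique, and the exact second-order expansion of the cost around it
    ([cost_ge_stationary]) makes it the only minimizer.

    The probabilistic input is a single fact about conditional expectations
    ([cexpv_adjoint]): if [E[g^2 | G] = 1], then [h |-> g h] is an isometry of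
    [L^2(G)] and [X |-> E[g X | G]] is its adjoint. It is used with [g = 1] for
    [y'] and with [g = w_k] for [z']. *)

(** * Conditional expectations *)

Section ConditionalExpectationTheory.
Context {d : measure_display} {T : measurableType d} {R : realType}.
Variable P : probability T R.
Implicit Types (G : set (set T)) (X Y Z h f g : T -> R).

Lemma sub_measurableW G F X : G `<=` <<s F >> -> sub_measurable G X ->
  sub_measurable F X.
Proof.
move=> GF mX _ B mB; have /= XB := mX measurableT B mB.
by apply: (smallest_sub (smallest_sigma_algebra setT F) GF); exact: XB.
Qed.

Variables (G : set (set T)) (sG : G `<=` @measurable d T).

Lemma sub_measurable_measurable X :
  sub_measurable G X -> measurable_fun setT X.
Proof.
move=> mX _ B mB; have /= XB := mX measurableT B mB.
by apply: (smallest_sub (@sigma_algebra_measurable _ T) sG); exact: XB.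
Qed.

Lemma generated_measurable A : <<s G >> A -> measurable A.
Proof. exact: (smallest_sub (@sigma_algebra_measurable _ T) sG). Qed.

Let idG : T -> g_sigma_algebraType G := id.

Let measurable_idG : measurable_fun [set: T] idG.
Proof. by move=> _ B mB; rewrite setTI; exact: generated_measurable. Qed.

HB.instance Definition _ := isMeasurableFun.Build _ _ _ _ idG measurable_idG.

(** The version is the Radon-Nikodym derivative, on the smaller sigma-algebra,
    of the charge [A |-> int_A X dP] with respect to the image of [P] under the
    identity. *)
Lemma cexpP X : P.-integrable setT (EFin \o X) -> is_cexp P G X (cexp P G X).
Proof.
move=> iX; rewrite /cexp; set S := [set Y | _].
suff [Y SY] : S !=set0 by exact: (@xgetPex _ _ S (ex_intro _ Y SY)).
pose PG : probability (g_sigma_algebraType G) R := distribution P idG.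
pose nu_ : {charge set (g_sigma_algebraType G) -> \bar R} :=
  pushforward (induced_charge iX) idG.
pose nu := nu_ measurable_idG.
have nuP : nu `<< PG.
  apply/null_content_dominatesP => A mA PA0.
  rewrite /nu /nu_ /= /pushforward /induced_charge.
  have mA' : measurable (idG @^-1` A) by exact: generated_measurable.
  by apply: null_set_integral => //; exact: (measurable_funTS (measurable_int P iX)).
pose D := Radon_Nikodym nu PG.
have fD t : D t \is a fin_num by rewrite /D; apply: Radon_Nikodym_fin_num nuP.
have iD : PG.-integrable setT D by apply: Radon_Nikodym_integrable nuP.
have DE : EFin \o (fun t => fine (D t)) = D by apply/funext => t /=; rewrite fineK.
have mD : measurable_fun setT D by exact: (measurable_int PG iD).
have mY : sub_measurable G (fun t => fine (D t)).
  by apply/measurable_EFinP; rewrite DE.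
have iY : P.-integrable setT (EFin \o (fun t => fine (D t))).
  apply/integrableP; split.
    by apply/measurable_EFinP; exact: sub_measurable_measurable.
  have /integrableP[_] := iD; rewrite ge0_integral_pushforward//.
  - by rewrite preimage_setT -DE.
  - exact: measurableT_comp.
exists (fun t => fine (D t)); split => // A GA.
have mA : measurable (A : set (g_sigma_algebraType G)) by [].
have := Radon_Nikodym_integral nuP mA; rewrite /nu /nu_ /= /pushforward /induced_charge.
rewrite preimage_id => ->.
rewrite -[Radon_Nikodym _ _]/D -DE integral_pushforward//; first by rewrite DE.
rewrite preimage_id; apply: (integrableS measurableT) => //.
exact: generated_measurable.
Qed.

Import HBNNSimple.

(** Simple functions reduce this to indicators of events of [G]. The integrals
    may be infinite, which is what lets it prove integrability below. *)
Lemma ge0_sub_measurable_integralM f g h :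
  measurable_fun setT f -> measurable_fun setT g ->
  (forall t, 0 <= f t) -> (forall t, 0 <= g t) ->
  (forall A, <<s G >> A ->
    (\int[P]_(t in A) (f t)%:E = \int[P]_(t in A) (g t)%:E)%E) ->
  sub_measurable G h -> (forall t, 0 <= h t) ->
  (\int[P]_t (h t * f t)%:E = \int[P]_t (h t * g t)%:E)%E.
Proof.
move=> mf mg f0 g0 fg mh h0.
have mhE : measurable_fun [set: g_sigma_algebraType G] (EFin \o h).
  exact/measurable_EFinP.
pose s n : {nnsfun g_sigma_algebraType G >-> R} :=
  nnsfun_approx measurableT mhE n.
have scvg t : (EFin \o (fun n => s n t)) @ \oo --> (h t)%:E.
  by apply: cvg_nnsfun_approx => // u _; rewrite /= lee_fin.
have snd t : {homo (fun n => s n t) : n k / (n <= k)%N >-> n <= k}.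
  by move=> n k nk; have /lefP := nd_nnsfun_approx measurableT mhE nk; exact.
have ms n : measurable_fun [set: T] (s n : T -> R).
  by apply: sub_measurable_measurable; exact: measurable_funP.
have stepE (e : T -> R) : measurable_fun setT e -> (forall t, 0 <= e t) ->
    (\int[P]_t (h t * e t)%:E = limn (fun n => \int[P]_t (s n t * e t)%:E))%E.
  move=> me e0; apply/esym/cvg_lim => //.
  have -> : (\int[P]_t (h t * e t)%:E
      = \int[P]_t limn (fun n => (s n t * e t)%:E))%E.
    apply: eq_integral => t _; apply/esym/cvg_lim => //.
    exact: (cvgeZr (isT : (e t)%:E \is a fin_num) (scvg t)).
  apply: cvg_monotone_convergence => //.
  - by move=> n; apply/measurable_EFinP; apply: measurable_funM.
  - by move=> n t _; rewrite lee_fin mulr_ge0.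
  - by move=> t _ n k nk; rewrite lee_fin ler_wpM2r//; exact: snd.
rewrite (stepE f)// (stepE g)//; congr (limn _); apply/funext => n.
have simpleE (e : T -> R) : measurable_fun setT e -> (forall t, 0 <= e t) ->
    (\int[P]_t (s n t * e t)%:E = \sum_(r \in range (s n))
       (r%:E * \int[P]_(t in s n @^-1` [set r]) (e t)%:E))%E.
  move=> me e0.
  have mr r : measurable (s n @^-1` [set r] : set T).
    by apply: generated_measurable; exact: (measurable_funPTI (s n)).
  transitivity (\int[P]_t (\sum_(r \in range (s n))
      ((r * \1_(s n @^-1` [set r]) t * e t)%:E)))%E.
    apply: eq_integral => t _.
    rewrite fsumEFin//; congr EFin.
    rewrite {1}(fimfunE (s n) t) !fsbig_finite//= big_distrl//=.
  rewrite ge0_integral_fsum//; last 2 first.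
  - move=> r; apply/measurable_EFinP; apply: measurable_funM => //.
    by apply: measurable_funM => //; exact: measurable_indic.
  - move=> r t _; rewrite lee_fin mulr_ge0//.
    have := nnfun_muleindic_ge0 (s n) r t.
    by rewrite -EFinM lee_fin.
  apply: eq_fsbigr => r /set_mem[t _ rt].
  have r0 : 0 <= r by rewrite -rt.
  rewrite [in RHS]integral_mkcond -ge0_integralZl//.
  - apply: eq_integral => u _; rewrite patchE -mulrA EFinM; congr (_ * _)%E.
    rewrite indicE; case: ifPn => _; by rewrite ?mul1r ?mul0r.
  - rewrite -measurable_restrict//; exact/measurable_EFinP/measurable_funTS.
  - by move=> u _; rewrite patchE; case: ifPn; rewrite ?lee_fin.
rewrite !simpleE//; apply: eq_fsbigr => r _; congr (_ * _)%E; apply: fg.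
exact: (measurable_funPTI (s n)).
Qed.


Local Notation Int X := (P.-integrable [set: T] (EFin \o X)).
Local Notation Ex X := (Rintegral P [set: T] X).

Lemma integrable_measurable X : Int X -> measurable_fun setT X.
Proof. by move=> /(measurable_int P)/measurable_EFinP. Qed.

Lemma integrable_le X Y : measurable_fun setT X -> (forall t, `|X t| <= Y t) ->
  Int Y -> Int X.
Proof.
move=> mX XY iY; apply: le_integrable iY => //; first exact/measurable_EFinP.
by move=> t _ /=; rewrite lee_fin (le_trans (XY t))// ler_norm.
Qed.

Lemma integrable_add X Y : Int X -> Int Y -> Int (fun t => X t + Y t).
Proof. by move=> iX iY; exact: (integrableD measurableT iX iY). Qed.

Lemma integrable_scale c X : Int X -> Int (fun t => c * X t).
Proof. by move=> iX; exact: (integrableZl measurableT c iX). Qed.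

Lemma integrable_abs X : Int X -> Int (fun t => `|X t|).
Proof. by move=> /integrable_norm. Qed.

Lemma integrable_ge0 X : measurable_fun setT X -> (forall t, 0 <= X t) ->
  (\int[P]_t (X t)%:E < +oo)%E -> Int X.
Proof.
move=> mX X0 fX; apply/integrableP; split; first exact/measurable_EFinP.
rewrite (eq_integral (fun t => (X t)%:E))// => t _.
by rewrite /= ger0_norm.
Qed.

Lemma EFin_expect X : Int X -> (Ex X)%:E = (\int[P]_t (X t)%:E)%E.
Proof. by move=> iX; rewrite /Rintegral fineK//; exact: integrable_fin_num. Qed.

Lemma le_expect X Y : Int X -> Int Y -> (forall t, X t <= Y t) -> Ex X <= Ex Y.
Proof. by move=> iX iY XY; apply: le_Rintegral. Qed.

Lemma expect_ge0 X : (forall t, 0 <= X t) -> 0 <= Ex X.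
Proof. by move=> X0; exact: Rintegral_ge0. Qed.

(* Adding [`|X| + `|Z|] to both [X] and [Z] makes them nonnegative without
   changing the difference of their integrals. *)
Let ge0_expect_cexpM X Z h : is_cexp P G X Z -> sub_measurable G h ->
  (forall t, 0 <= h t) ->
  Int (fun t => h t * X t) -> Int (fun t => h t * Z t) ->
  Ex (fun t => h t * X t) = Ex (fun t => h t * Z t).
Proof.
move=> [iX mZ iZ XZ] mh h0 ihX ihZ.
have mh' := sub_measurable_measurable mh.
pose A t := `|X t| + `|Z t|.
have iA : Int A by apply: integrable_add; exact: integrable_abs.
have ihA : Int (fun t => h t * A t).
  apply: (@integrable_le _ (fun t => `|h t * X t| + `|h t * Z t|)).
  - by apply: measurable_funM => //; exact: integrable_measurable.
  - by move=> t; rewrite /A ger0_norm ?mulr_ge0 ?addr_ge0// !normrM (ger0_norm (h0 t)) mulrDr.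
  - by apply: integrable_add; exact: integrable_abs.
have := @ge0_sub_measurable_integralM (fun t => A t + X t) (fun t => A t + Z t) h.
have A0 (B : T -> R) : (forall t, `|B t| <= A t) -> forall t, 0 <= A t + B t.
  by move=> BA t; have := BA t; rewrite ler_norml => /andP[+ _]; lra.
have E1 (B : T -> R) (D : set T) : measurable D -> Int B ->
    (\int[P]_(t in D) (A t + B t)%:E =
     \int[P]_(t in D) (A t)%:E + \int[P]_(t in D) (B t)%:E)%E.
  by move=> mD iB; rewrite -integralD_EFin//; apply: (integrableS measurableT).
have E2 (B : T -> R) : Int (fun t => h t * B t) ->
    (\int[P]_t (h t * (A t + B t))%:E =
     (Ex (fun t => h t * A t))%:E + (Ex (fun t => h t * B t))%:E)%E.
  move=> ihB; rewrite !EFin_expect// -integralD_EFin//.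
  by apply: eq_integral => t _; rewrite mulrDr.
rewrite !E2// => E; suff : (Ex (fun t => h t * A t))%:E + (Ex (fun t => h t * X t))%:E
    = ((Ex (fun t => h t * A t))%:E + (Ex (fun t => h t * Z t))%:E) :> \bar R.
  by rewrite -!EFinD => -[] /addrI.
apply: E => //.
- by apply: measurable_funD; exact: integrable_measurable.
- by apply: measurable_funD; exact: integrable_measurable.
- by apply: A0 => t; rewrite lerDl.
- by apply: A0 => t; rewrite lerDr.
- move=> D GD; have mD := generated_measurable GD.
  by rewrite !E1// XZ.
Qed.

Lemma expect_cexpM X Z h : is_cexp P G X Z -> sub_measurable G h ->
  Int (fun t => h t * X t) -> Int (fun t => h t * Z t) ->
  Ex (fun t => h t * X t) = Ex (fun t => h t * Z t).
Proof.
move=> XZ mh ihX ihZ; have [iX mZ iZ _] := XZ.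
pose p t := Num.max (h t) 0; pose q t := Num.max (- h t) 0.
have hpq t : h t = p t - q t.
  by rewrite /p /q !maxEle; do 2 case: ifPn; rewrite -?ltNge; lra.
have mp : sub_measurable G p by apply: measurable_maxr.
have mq : sub_measurable G q.
  by apply: measurable_maxr => //; exact: measurable_funN.
have part (B : T -> R) : Int B -> Int (fun t => h t * B t) ->
    [/\ Int (fun t => p t * B t), Int (fun t => q t * B t) &
     Ex (fun t => h t * B t) = Ex (fun t => p t * B t) - Ex (fun t => q t * B t)].
  move=> iB ihB.
  have dom (r : T -> R) : sub_measurable G r -> (forall t, `|r t| <= `|h t|) ->
      Int (fun t => r t * B t).
    move=> mr rh; apply: (@integrable_le _ (fun t => `|h t * B t|)).
    - apply: measurable_funM; first exact: sub_measurable_measurable.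
      exact: integrable_measurable.
    - by move=> t; rewrite !normrM ler_wpM2r.
    - exact: integrable_abs.
  have ip : Int (fun t => p t * B t).
    apply: dom => // t; rewrite /p maxEle; case: ifPn => _ //.
    by rewrite normr0.
  have iq : Int (fun t => q t * B t).
    apply: dom => // t; rewrite /q maxEle; case: ifPn => _.
      by rewrite normr0.
    by rewrite normrN.
  split => //; rewrite -RintegralB//; apply: eq_Rintegral => t _.
  by rewrite hpq mulrBl.
have [ipX iqX ->] := part X iX ihX; have [ipZ iqZ ->] := part Z iZ ihZ.
by congr (_ - _); apply: ge0_expect_cexpM => // t; rewrite le_max lexx orbT.
Qed.

Lemma integrable_mul X Y : measurable_fun setT X -> measurable_fun setT Y ->
  Int (fun t => X t ^+ 2) -> Int (fun t => Y t ^+ 2) -> Int (fun t => X t * Y t).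
Proof.
move=> mX mY iX iY.
apply: (@integrable_le _ (fun t => X t ^+ 2 + Y t ^+ 2)).
- exact: measurable_funM.
- move=> t; have := sqr_ge0 (`|X t| - `|Y t|); rewrite normrM.
  rewrite -(real_normK (num_real (X t))) -(real_normK (num_real (Y t))).
  by have := normr_ge0 (X t); have := normr_ge0 (Y t); nra.
- exact: integrable_add.
Qed.

Section UnitMultiplier.
Variable g : T -> R.
Hypotheses (mg : measurable_fun setT g)
  (g1 : is_cexp P G (fun t => g t ^+ 2) (fun=> 1)).

(** [E[g^2 | G] = 1] makes multiplication by [g] an isometry on [L^2(G)]. *)
Lemma square_unit_multiplier h : sub_measurable G h -> Int (fun t => h t ^+ 2) ->
  Int (fun t => (g t * h t) ^+ 2) /\
  Ex (fun t => (g t * h t) ^+ 2) = Ex (fun t => h t ^+ 2).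
Proof.
move=> mh ih; have mh' := sub_measurable_measurable mh.
have E : (\int[P]_t ((g t * h t) ^+ 2)%:E = \int[P]_t (h t ^+ 2)%:E)%E.
  transitivity (\int[P]_t (h t ^+ 2 * g t ^+ 2)%:E)%E.
    by apply: eq_integral => t _; rewrite -exprMn mulrC.
  transitivity (\int[P]_t (h t ^+ 2 * 1)%:E)%E; last first.
    by apply: eq_integral => t _; rewrite mulr1.
  apply: (@ge0_sub_measurable_integralM (fun t => g t ^+ 2) (fun=> 1)) => //.
  - exact: measurable_funX.
  - by move=> t; rewrite sqr_ge0.
  - by move=> A GA; case: g1 => _ _ _ /(_ A GA) <-.
  - exact: measurable_funX.
  - by move=> t; rewrite sqr_ge0.
split; last by rewrite /Rintegral E.
apply: integrable_ge0; last by rewrite E -EFin_expect// ltry.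
  by apply: measurable_funX; exact: measurable_funM.
by move=> t; rewrite sqr_ge0.
Qed.

(** Testing [Z] against its own truncation [Z 1_(`|Z| <= j)] bounds the
    truncation in [L^2] uniformly in [j]; this yields the square-integrability of
    [Z], although [g X] itself need only be integrable. *)
Lemma cexp_square_le X Z : measurable_fun setT X -> Int (fun t => X t ^+ 2) ->
  is_cexp P G (fun t => g t * X t) Z ->
  Int (fun t => Z t ^+ 2) /\ Ex (fun t => Z t ^+ 2) <= Ex (fun t => X t ^+ 2).
Proof.
move=> mX iX XZ; have [igX mZ iZ _] := XZ.
have mZ' := sub_measurable_measurable mZ.
pose A (j : nat) := [set t | `|Z t| <= j%:R].
have GA j : <<s G >> (A j).
  have mn : measurable_fun [set: g_sigma_algebraType G] (Num.norm \o Z).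
    exact: measurableT_comp.
  have := mn measurableT `]-oo, j%:R]%classic (measurable_itv _).
  have -> // : [set: g_sigma_algebraType G] `&` (Num.norm \o Z) @^-1` `]-oo, j%:R] = A j.
  by rewrite setTI; apply/seteqP; split => t; rewrite /A /= in_itv.
have mA j : measurable (A j) by exact: generated_measurable.
have bound j : (\int[P]_(t in A j) (Z t ^+ 2)%:E <= (Ex (fun t => X t ^+ 2))%:E)%E.
  pose h t := Z t * \1_(A j) t.
  have mh : sub_measurable G h.
    by apply: measurable_funM => //; apply: measurable_indic; exact: GA.
  have mh' := sub_measurable_measurable mh.
  have hj t : `|h t| <= j%:R.
    rewrite /h indicE; case: (boolP (t \in A j)) => [/set_mem|_].
      by rewrite mulr1.
    by rewrite mulr0 normr0.
  have ihB (B : T -> R) : Int B -> Int (fun t => h t * B t).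
    move=> iB; apply: (@integrable_le _ (fun t => j%:R * `|B t|)).
    - by apply: measurable_funM => //; exact: integrable_measurable.
    - by move=> t; rewrite normrM ler_wpM2r.
    - by apply: integrable_scale; exact: integrable_abs.
  have hZ t : h t * Z t = h t ^+ 2.
    rewrite /h indicE; case: (t \in A j); rewrite ?mulr0 ?mulr1 ?mul0r ?expr2 //.
    by rewrite mul0r.
  have ih2 : Int (fun t => h t ^+ 2).
    by have := ihB _ iZ; under eq_fun do rewrite hZ.
  have [igh Egh] := square_unit_multiplier mh ih2.
  have E1 : Ex (fun t => h t * (g t * X t)) = Ex (fun t => h t ^+ 2).
    rewrite (expect_cexpM XZ mh (ihB _ igX) (ihB _ iZ)).
    by apply: eq_Rintegral => t _; rewrite hZ.
  have E2 : 2 * Ex (fun t => h t * (g t * X t)) <=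
      Ex (fun t => (g t * h t) ^+ 2) + Ex (fun t => X t ^+ 2).
    rewrite -RintegralD// -RintegralZl//; last exact: ihB.
    apply: le_expect; [|exact: integrable_add|].
      by apply: integrable_scale; exact: ihB.
    by move=> t; have := sqr_ge0 (g t * h t - X t); nra.
  have -> : (\int[P]_(t in A j) (Z t ^+ 2)%:E = \int[P]_t (h t ^+ 2)%:E)%E.
    rewrite integral_mkcond; apply: eq_integral => t _.
    rewrite patchE /h indicE; case: (t \in A j); rewrite ?mulr1 ?mulr0 //.
    by rewrite expr0n.
  by rewrite -EFin_expect// lee_fin; move: E2; rewrite E1 Egh; lra.
have AT : \bigcup_j A j = setT.
  apply/seteqP; split => // t _; exists (Num.truncn `|Z t|).+1 => //=.
  by rewrite /A /= ltW// truncnS_gt.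
have lim : (\int[P]_t (Z t ^+ 2)%:E <= (Ex (fun t => X t ^+ 2))%:E)%E.
  have : (\int[P]_(t in A j) (Z t ^+ 2)%:E)%E @[j --> \oo]
      --> (\int[P]_(t in \bigcup_j A j) (Z t ^+ 2)%:E)%E.
    apply: ge0_nondecreasing_set_cvg_integral => //.
    - move=> i j ij; apply/subsetPset => t /= ti; apply: le_trans ti _.
      by rewrite ler_nat.
    - by move=> j; apply/measurable_EFinP/measurable_funTS/measurable_funX.
    - by move=> j t _; rewrite lee_fin sqr_ge0.
  by rewrite AT => /cvge_to_le; apply; exact: nearW.
have iZ2 : Int (fun t => Z t ^+ 2).
  apply: integrable_ge0; [exact: measurable_funX|by move=> t; rewrite sqr_ge0|].
  exact: le_lt_trans lim (ltry _).
by split => //; rewrite -lee_fin EFin_expect.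
Qed.

End UnitMultiplier.
End ConditionalExpectationTheory.

(** * Random vectors and their scalar product *)

Section VectorAlgebra.
Context {R : realType}.

Lemma dotvC n (u v : 'cV[R]_n) : dotv u v = dotv v u.
Proof. by apply: eq_bigr => i _; rewrite mulrC. Qed.

Lemma dotvDl n (u v x : 'cV[R]_n) : dotv (u + v) x = dotv u x + dotv v x.
Proof. by rewrite -big_split; apply: eq_bigr => i _; rewrite mxE mulrDl. Qed.

Lemma dotvZl n c (u x : 'cV[R]_n) : dotv (c *: u) x = c * dotv u x.
Proof. by rewrite big_distrr; apply: eq_bigr => i _; rewrite mxE /= mulrA. Qed.

Lemma dotvNl n (u x : 'cV[R]_n) : dotv (- u) x = - dotv u x.
Proof. by rewrite -scaleN1r dotvZl mulN1r. Qed.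

Lemma dotvBl n (u v x : 'cV[R]_n) : dotv (u - v) x = dotv u x - dotv v x.
Proof. by rewrite dotvDl dotvNl. Qed.

Lemma dotvDr n (u v x : 'cV[R]_n) : dotv x (u + v) = dotv x u + dotv x v.
Proof. by rewrite dotvC dotvDl !(dotvC x). Qed.

Lemma dotvZr n c (u x : 'cV[R]_n) : dotv x (c *: u) = c * dotv x u.
Proof. by rewrite dotvC dotvZl dotvC. Qed.

Lemma dotvNr n (u x : 'cV[R]_n) : dotv x (- u) = - dotv x u.
Proof. by rewrite dotvC dotvNl dotvC. Qed.

Lemma dotvBr n (u v x : 'cV[R]_n) : dotv x (u - v) = dotv x u - dotv x v.
Proof. by rewrite dotvDr dotvNr. Qed.

Lemma dotv0l n (x : 'cV[R]_n) : dotv 0 x = 0.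
Proof. by rewrite -(scale0r (0 : 'cV[R]_n)) dotvZl mul0r. Qed.

Lemma dotv_ge0 n (u : 'cV[R]_n) : 0 <= dotv u u.
Proof. by apply: sumr_ge0 => i _; rewrite -expr2 sqr_ge0. Qed.

Lemma dotv_eq0 n (u : 'cV[R]_n) : dotv u u = 0 -> u = 0.
Proof.
move=> /eqP; rewrite psumr_eq0 => [/allP u0|i _]; last by rewrite -expr2 sqr_ge0.
apply/matrixP => i j; rewrite (ord1 j) mxE; apply/eqP.
by have := u0 i (mem_index_enum i); rewrite /= mulf_eq0 orbb.
Qed.

Lemma dotv_mulmxl p q (A : 'M[R]_(p, q)) u v :
  dotv (A *m u) v = dotv u (A^T *m v).
Proof.
rewrite /dotv; under eq_bigr do rewrite mxE big_distrl /=.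
rewrite exchange_big /=; apply: eq_bigr => j _.
rewrite mxE big_distrr /=; apply: eq_bigr => i _.
by rewrite mxE mulrCA mulrA.
Qed.

Lemma dotv_sqD n (u v : 'cV[R]_n) :
  dotv (u + v) (u + v) = dotv u u + 2 * dotv u v + dotv v v.
Proof. by rewrite !dotvDl !dotvDr (dotvC v u); ring. Qed.

Lemma dotv_sqB n (u v : 'cV[R]_n) :
  dotv (u - v) (u - v) = dotv u u - 2 * dotv u v + dotv v v.
Proof. by rewrite !dotvBl !dotvBr (dotvC v u); ring. Qed.

Lemma dotv_young n (u v : 'cV[R]_n) : `|dotv u v| <= dotv u u + dotv v v.
Proof.
have := dotv_ge0 (u + v); have := dotv_ge0 (u - v); rewrite dotv_sqB dotv_sqD.
have := dotv_ge0 u; have := dotv_ge0 v; rewrite ler_norml => ? ? ? ?.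
by apply/andP; split; lra.
Qed.

Lemma dotvD_le n (u v : 'cV[R]_n) :
  dotv (u + v) (u + v) <= 2 * (dotv u u + dotv v v).
Proof. by have := dotv_ge0 (u - v); rewrite dotv_sqB dotv_sqD; lra. Qed.

Lemma sqr_sum_le (I : Type) (s : seq I) (a : I -> R) :
  (\sum_(i <- s) a i) ^+ 2 <= 2 ^+ size s * \sum_(i <- s) a i ^+ 2.
Proof.
elim: s => [|i s IH]; first by rewrite !big_nil expr0n mulr0.
rewrite !big_cons /= [2 ^+ _.+1]exprS; move: IH; set S := \sum_(j <- s) a j.
have : 1 <= 2 ^+ size s :> R by rewrite exprn_ege1// ler1n.
move: (2 ^+ size s) (\sum_(j <- s) _) (a i) => K Q b K1 SQ.
have b2 : b ^+ 2 <= K * b ^+ 2 by rewrite ler_peMl// sqr_ge0.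
by have := sqr_ge0 (b - S); nra.
Qed.

Lemma dotv_mulmx_le p q c (A : 'M[R]_(p, q)) u : (forall i j, `|A i j| <= c) ->
  dotv (A *m u) (A *m u) <= (2 ^+ q * c ^+ 2 *+ p) * dotv u u.
Proof.
move=> Ac; have row (i : 'I_p) : (A *m u) i 0 * (A *m u) i 0 <=
    2 ^+ q * c ^+ 2 * dotv u u.
  rewrite -expr2 mxE; apply: le_trans (sqr_sum_le _ _) _.
  have -> : size (index_enum 'I_q) = q.
    rewrite -(card_uniqP (index_enum_uniq _)) -[RHS]card_ord.
    by apply: eq_card => j; rewrite mem_index_enum.
  rewrite -mulrA ler_wpM2l ?exprn_ge0//.
  rewrite /dotv big_distrr /=; apply: ler_sum => j _.
  rewrite exprMn -expr2 ler_wpM2r ?sqr_ge0//.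
  rewrite -(real_normK (num_real (A i j))) lerXn2r// ?nnegrE//.
  exact: le_trans (Ac i j).
rewrite mulrnAl; have -> : (2 ^+ q * c ^+ 2 * dotv u u) *+ p =
    \sum_(i < p) (2 ^+ q * c ^+ 2 * dotv u u).
  by rewrite sumr_const card_ord.
exact: ler_sum.
Qed.

Lemma le_mx_norm p q (A : 'M[R]_(p, q)) i j : `|A i j| <= mx_norm A.
Proof.
rewrite mx_normrE.
by apply: (@le_bigmax _ _ _ _ (fun ij : 'I_p * 'I_q => `|A ij.1 ij.2|) (i, j)).
Qed.

End VectorAlgebra.

Section MatrixMeasurability.
Context {d : measure_display} {T : measurableType d} {R : realType}.

Definition mx_measurable {p q} (A : T -> 'M[R]_(p, q)) : Prop :=
  forall i j, measurable_fun [set: T] (fun t => A t i j).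

Lemma mx_measurableD p q (A B : T -> 'M[R]_(p, q)) :
  mx_measurable A -> mx_measurable B -> mx_measurable (fun t => A t + B t).
Proof.
move=> mA mB i j; under eq_fun do rewrite mxE.
by apply: measurable_funD; [exact: mA|exact: mB].
Qed.

Lemma mx_measurableN p q (A : T -> 'M[R]_(p, q)) :
  mx_measurable A -> mx_measurable (fun t => - A t).
Proof.
by move=> mA i j; under eq_fun do rewrite mxE; exact/measurable_funN/mA.
Qed.

Lemma mx_measurableB p q (A B : T -> 'M[R]_(p, q)) :
  mx_measurable A -> mx_measurable B -> mx_measurable (fun t => A t - B t).
Proof.
by move=> mA mB; apply: mx_measurableD => //; exact: mx_measurableN.
Qed.

Lemma mx_measurableZ p q (f : T -> R) (A : T -> 'M[R]_(p, q)) :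
  measurable_fun setT f -> mx_measurable A ->
  mx_measurable (fun t => f t *: A t).
Proof.
by move=> mf mA i j; under eq_fun do rewrite mxE; apply: measurable_funM.
Qed.

Lemma mx_measurable_cst p q (A : 'M[R]_(p, q)) : mx_measurable (fun=> A).
Proof. by move=> i j; exact: measurable_cst. Qed.

Lemma mx_measurableT p q (A : T -> 'M[R]_(p, q)) :
  mx_measurable A -> mx_measurable (fun t => (A t)^T).
Proof. by move=> mA i j; under eq_fun do rewrite mxE; exact: mA. Qed.

Lemma mx_measurableM p q r (A : T -> 'M[R]_(p, q)) (B : T -> 'M[R]_(q, r)) :
  mx_measurable A -> mx_measurable B -> mx_measurable (fun t => A t *m B t).
Proof.
move=> mA mB i j; under eq_fun do rewrite mxE.
by apply: measurable_sum => k; apply: measurable_funM; [exact: mA|exact: mB].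
Qed.

Lemma measurable_dotv p (X Y : T -> 'cV[R]_p) :
  mx_measurable X -> mx_measurable Y ->
  measurable_fun setT (fun t => dotv (X t) (Y t)).
Proof.
move=> mX mY; apply: measurable_sum => k.
by apply: measurable_funM; [exact: mX|exact: mY].
Qed.

Lemma measurable_det p (A : T -> 'M[R]_p) :
  mx_measurable A -> measurable_fun setT (fun t => \det (A t)).
Proof.
move=> mA; apply: measurable_sum => s.
by apply: measurable_funM => //; apply: measurable_prod => i _; exact: mA.
Qed.

Lemma measurable_inv (f : T -> R) :
  measurable_fun setT f -> measurable_fun setT (fun t => (f t)^-1).
Proof.
move=> mf; have mabs : measurable_fun setT (fun t => `|f t|) by exact: measurableT_comp.
(* [1/f = f * `|f|^(-2)], which remains true where [f] vanishes. *)
have -> : (fun t => (f t)^-1) = (fun t => f t * (`|f t| `^ (-2))).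
  apply/funext => t; have [->|f0] := eqVneq (f t) 0; first by rewrite invr0 mul0r.
  rewrite powRN powR_mulrn// real_normK ?num_real//.
  by rewrite expr2 invfM mulrA divff// mul1r.
apply: measurable_funM => //.
exact: (measurableT_comp (measurable_powR (-2)) mabs).
Qed.

Lemma mx_measurable_inv p (A : T -> 'M[R]_p) :
  mx_measurable A -> (forall t, A t \in unitmx) ->
  mx_measurable (fun t => invmx (A t)).
Proof.
move=> mA uA i j.
have -> : (fun t => invmx (A t) i j) =
    (fun t => (\det (A t))^-1 * cofactor (A t) j i).
  by apply/funext => t; rewrite /invmx uA !mxE.
apply: measurable_funM; first exact/measurable_inv/measurable_det.
rewrite /cofactor; apply: measurable_funM => //.
by apply: measurable_det => k l; under eq_fun do rewrite !mxE; exact: mA.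
Qed.

End MatrixMeasurability.

(** * Square-integrable random vectors *)

Section RandomVectors.
Context {d : measure_display} {T : measurableType d} {R : realType}.
Variable P : probability T R.
Local Notation Int X := (P.-integrable [set: T] (EFin \o X)).
Local Notation Ex X := (Rintegral P [set: T] X).

Definition square_integrable {p} (X : T -> 'cV[R]_p) : Prop :=
  mx_measurable X /\ Int (fun t => dotv (X t) (X t)).

Definition ip {p} (X Y : T -> 'cV[R]_p) : R := Ex (fun t => dotv (X t) (Y t)).

Local Notation L2 := square_integrable.

Lemma integrable_dotv p (X Y : T -> 'cV[R]_p) : L2 X -> L2 Y ->
  Int (fun t => dotv (X t) (Y t)).
Proof.
move=> [mX iX] [mY iY].
apply: (@integrable_le _ _ _ _ _ (fun t => dotv (X t) (X t) + dotv (Y t) (Y t))).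
- exact: measurable_dotv.
- by move=> t; exact: dotv_young.
- exact: integrable_add.
Qed.

Lemma L2_0 p : L2 (fun=> 0 : 'cV[R]_p).
Proof.
split; first exact: mx_measurable_cst.
by under eq_fun do rewrite dotv0l; exact: integrable0.
Qed.

Lemma L2D p (X Y : T -> 'cV[R]_p) : L2 X -> L2 Y -> L2 (fun t => X t + Y t).
Proof.
move=> LX LY; have [mX iX] := LX; have [mY iY] := LY.
have mXY := mx_measurableD mX mY; split => //.
apply: (@integrable_le _ _ _ _ _
  (fun t => 2 * (dotv (X t) (X t) + dotv (Y t) (Y t)))).
- exact: measurable_dotv.
- by move=> t; rewrite ger0_norm ?dotv_ge0// dotvD_le.
- by apply: integrable_scale; exact: integrable_add.
Qed.

Lemma L2Z p c (X : T -> 'cV[R]_p) : L2 X -> L2 (fun t => c *: X t).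
Proof.
move=> [mX iX]; split; first by apply: mx_measurableZ.
under eq_fun do rewrite dotvZl dotvZr.
by do 2 apply: integrable_scale.
Qed.

Lemma L2N p (X : T -> 'cV[R]_p) : L2 X -> L2 (fun t => - X t).
Proof. by move=> /(L2Z (-1)); under eq_fun do rewrite scaleN1r. Qed.

Lemma L2B p (X Y : T -> 'cV[R]_p) : L2 X -> L2 Y -> L2 (fun t => X t - Y t).
Proof. by move=> LX LY; apply: L2D => //; exact: L2N. Qed.

Lemma ipC p (X Y : T -> 'cV[R]_p) : ip X Y = ip Y X.
Proof. by apply: eq_Rintegral => t _; rewrite dotvC. Qed.

Lemma ipDl p (X Y Z : T -> 'cV[R]_p) : L2 X -> L2 Y -> L2 Z ->
  ip (fun t => X t + Y t) Z = ip X Z + ip Y Z.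
Proof.
move=> LX LY LZ; rewrite /ip -RintegralD//; [|exact: integrable_dotv..].
by apply: eq_Rintegral => t _; rewrite dotvDl.
Qed.

Lemma ipZl p c (X Z : T -> 'cV[R]_p) : L2 X -> L2 Z ->
  ip (fun t => c *: X t) Z = c * ip X Z.
Proof.
move=> LX LZ; rewrite /ip -RintegralZl//; last exact: integrable_dotv.
by apply: eq_Rintegral => t _; rewrite dotvZl.
Qed.

Lemma ipNl p (X Z : T -> 'cV[R]_p) : L2 X -> L2 Z ->
  ip (fun t => - X t) Z = - ip X Z.
Proof.
move=> LX LZ; rewrite -mulN1r -ipZl//.
by apply: eq_Rintegral => t _; rewrite scaleN1r.
Qed.

Lemma ipBl p (X Y Z : T -> 'cV[R]_p) : L2 X -> L2 Y -> L2 Z ->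
  ip (fun t => X t - Y t) Z = ip X Z - ip Y Z.
Proof. by move=> LX LY LZ; rewrite ipDl ?ipNl//; exact: L2N. Qed.

Lemma ipDr p (X Y Z : T -> 'cV[R]_p) : L2 X -> L2 Y -> L2 Z ->
  ip Z (fun t => X t + Y t) = ip Z X + ip Z Y.
Proof. by move=> LX LY LZ; rewrite ipC ipDl// !(ipC Z). Qed.

Lemma ipZr p c (X Z : T -> 'cV[R]_p) : L2 X -> L2 Z ->
  ip Z (fun t => c *: X t) = c * ip Z X.
Proof. by move=> LX LZ; rewrite ipC ipZl// ipC. Qed.

Lemma ipNr p (X Z : T -> 'cV[R]_p) : L2 X -> L2 Z ->
  ip Z (fun t => - X t) = - ip Z X.
Proof. by move=> LX LZ; rewrite ipC ipNl// ipC. Qed.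

Lemma ipBr p (X Y Z : T -> 'cV[R]_p) : L2 X -> L2 Y -> L2 Z ->
  ip Z (fun t => X t - Y t) = ip Z X - ip Z Y.
Proof. by move=> LX LY LZ; rewrite ipC ipBl// !(ipC Z). Qed.

Lemma ip_mulmxl p q (A : T -> 'M[R]_(p, q)) X Y :
  ip (fun t => A t *m X t) Y = ip X (fun t => (A t)^T *m Y t).
Proof. by apply: eq_Rintegral => t _; rewrite dotv_mulmxl. Qed.

Lemma ip_ae p (X X' Y Y' : T -> 'cV[R]_p) : L2 X -> L2 Y ->
  mx_measurable X' -> mx_measurable Y' ->
  (\forall t \ae P, X t = X' t) -> (\forall t \ae P, Y t = Y' t) ->
  ip X Y = ip X' Y'.
Proof.
move=> [mX _] [mY _] mX' mY' XX YY; rewrite /ip /Rintegral; congr fine.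
apply: ae_eq_integral => //.
- by apply/measurable_EFinP; exact: measurable_dotv.
- by apply/measurable_EFinP; exact: measurable_dotv.
- by apply: filterS2 XX YY => t -> ->.
Qed.

Lemma nsq_ge0 p (X : T -> 'cV[R]_p) : 0 <= ip X X.
Proof. by apply: expect_ge0 => t; exact: dotv_ge0. Qed.

Lemma nsq_eq0 p (X : T -> 'cV[R]_p) : L2 X -> ip X X = 0 ->
  \forall t \ae P, X t = 0.
Proof.
move=> [mX iX] X0.
have : ae_eq P setT (fun t => (dotv (X t) (X t))%:E) (cst 0%E).
  apply/ae_eq_integral_abs => //.
    by apply/measurable_EFinP; exact: measurable_dotv.
  rewrite (eq_integral (fun t => (dotv (X t) (X t))%:E)) => [|t _].
    by rewrite -EFin_expect// -[Rintegral _ _ _]/(ip X X) X0.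
  by rewrite /= ger0_norm// dotv_ge0.
by apply: filterS => t /(_ I) [] /dotv_eq0.
Qed.

Lemma nsqD_le p (X Y : T -> 'cV[R]_p) : L2 X -> L2 Y ->
  ip (fun t => X t + Y t) (fun t => X t + Y t) <= 2 * (ip X X + ip Y Y).
Proof.
move=> LX LY; have iX := integrable_dotv LX LX; have iY := integrable_dotv LY LY.
rewrite /ip -RintegralD// -RintegralZl//; last exact: integrable_add.
apply: le_expect; last by move=> t; exact: dotvD_le.
  by apply: integrable_dotv; exact: L2D.
by apply: integrable_scale; exact: integrable_add.
Qed.

Lemma nsqB_le p (X Y : T -> 'cV[R]_p) : L2 X -> L2 Y ->
  ip (fun t => X t - Y t) (fun t => X t - Y t) <= 2 * (ip X X + ip Y Y).
Proof.
move=> LX LY; apply: le_trans (nsqD_le LX (L2N LY)) _.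
by rewrite ipNl ?ipNr ?opprK//; exact: L2N.
Qed.

Lemma nsqBC p (X Y : T -> 'cV[R]_p) :
  ip (fun t => X t - Y t) (fun t => X t - Y t) =
  ip (fun t => Y t - X t) (fun t => Y t - X t).
Proof.
by apply: eq_Rintegral => t _; rewrite -opprB dotvNl dotvNr opprK.
Qed.

Definition ess_bounded {p q} (A : T -> 'M[R]_(p, q)) : Prop :=
  exists c, \forall t \ae P, mx_norm (A t) <= c.

Lemma ess_boundedT p q (A : T -> 'M[R]_(p, q)) :
  ess_bounded A -> ess_bounded (fun t => (A t)^T).
Proof.
move=> [c Ac]; exists (Num.max c 0); apply: filterS Ac => t Ac.
rewrite mx_normrE; apply: bigmax_le; first by rewrite le_max lexx orbT.
by move=> ij _; rewrite mxE le_max (le_trans _ Ac)// le_mx_norm.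
Qed.

Lemma L2_mulmx p q (A : T -> 'M[R]_(p, q)) : mx_measurable A -> ess_bounded A ->
  exists2 K, 0 <= K & forall X, L2 X -> L2 (fun t => A t *m X t) /\
    ip (fun t => A t *m X t) (fun t => A t *m X t) <= K * ip X X.
Proof.
move=> mA [c Ac]; exists (2 ^+ q * c ^+ 2 *+ p).
  by rewrite mulrn_wge0// mulr_ge0// ?sqr_ge0// exprn_ge0.
move=> X [mX iX]; have mAX := mx_measurableM mA mX.
have bound : \forall t \ae P, dotv (A t *m X t) (A t *m X t) <=
    (2 ^+ q * c ^+ 2 *+ p) * dotv (X t) (X t).
  apply: filterS Ac => t Ac; apply: dotv_mulmx_le => i j.
  exact: le_trans (le_mx_norm _ _ _) Ac.
have le : (\int[P]_t (dotv (A t *m X t) (A t *m X t))%:E <=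
    \int[P]_t ((2 ^+ q * c ^+ 2 *+ p) * dotv (X t) (X t))%:E)%E.
  apply: ae_ge0_le_integral => //.
  - by move=> t _; rewrite lee_fin dotv_ge0.
  - by apply/measurable_EFinP; exact: measurable_dotv.
  - move=> t _; rewrite lee_fin mulr_ge0 ?dotv_ge0//.
    by rewrite mulrn_wge0// mulr_ge0// ?sqr_ge0// exprn_ge0.
  - apply/measurable_EFinP; apply: measurable_funM => //.
    exact: measurable_dotv.
  - by apply: filterS bound => t h _; rewrite lee_fin.
have iKX : Int (fun t => (2 ^+ q * c ^+ 2 *+ p) * dotv (X t) (X t)).
  exact: integrable_scale.
have iAX : Int (fun t => dotv (A t *m X t) (A t *m X t)).
  apply: integrable_ge0; [exact: measurable_dotv|by move=> t; exact: dotv_ge0|].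
  by apply: le_lt_trans le _; rewrite -EFin_expect// ltry.
split; first by split.
by rewrite /ip -RintegralZl// -lee_fin !EFin_expect.
Qed.

Lemma L2_component p (X : T -> 'cV[R]_p) i : L2 X ->
  [/\ measurable_fun setT (fun t => X t i 0), Int (fun t => X t i 0 ^+ 2) &
      Ex (fun t => X t i 0 ^+ 2) <= ip X X].
Proof.
move=> [mX iX]; have le t : X t i 0 ^+ 2 <= dotv (X t) (X t).
  rewrite /dotv (bigD1 i)//= expr2 lerDl.
  by apply: sumr_ge0 => j _; rewrite -expr2 sqr_ge0.
have iXi : Int (fun t => X t i 0 ^+ 2).
  apply: integrable_le iX; first by apply: measurable_funX; exact: mX.
  by move=> t; rewrite ger0_norm ?sqr_ge0.
by split => //; exact: le_expect.
Qed.

Lemma integrable_sqr_component p (X : T -> 'cV[R]_p) i : L2 X ->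
  Int (fun t => X t i 0 ^+ 2).
Proof. by move=> /(L2_component i)[]. Qed.

Lemma integrable_expect_sum (I : Type) (s : seq I) (f : I -> T -> R) :
  (forall i, Int (f i)) -> Int (fun t => \sum_(i <- s) f i t) /\
  Ex (fun t => \sum_(i <- s) f i t) = \sum_(i <- s) Ex (f i).
Proof.
move=> fi; elim: s => [|i s [IH1 IH2]].
  under eq_fun do rewrite big_nil; rewrite big_nil.
  split; first exact: integrable0.
  by rewrite Rintegral_cst// mul0r.
under eq_fun do rewrite big_cons; rewrite big_cons; split.
  exact: integrable_add.
by rewrite RintegralD// IH2.
Qed.

Section Cexpv.
Variables (G : set (set T)) (sG : G `<=` @measurable d T) (g : T -> R).
Hypotheses (mg : measurable_fun setT g)
  (g1 : is_cexp P G (fun t => g t ^+ 2) (fun=> 1)).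
Local Notation mxG := (@mx_measurable _ (g_sigma_algebraType G) R _ _).

Lemma mx_measurable_sub p q (A : T -> 'M[R]_(p, q)) :
  mxG A -> mx_measurable A.
Proof. by move=> mA i j; apply: (sub_measurable_measurable sG); exact: mA. Qed.

Lemma L2_unit_multiplier p (h : T -> 'cV[R]_p) : mxG h -> L2 h ->
  L2 (fun t => g t *: h t) /\
  ip (fun t => g t *: h t) (fun t => g t *: h t) = ip h h.
Proof.
move=> mh Lh; have [mh' ih] := Lh.
have E t : dotv (g t *: h t) (g t *: h t) = \sum_(i < p) (g t * h t i 0) ^+ 2.
  by apply: eq_bigr => i _; rewrite mxE expr2.
have comp i := @square_unit_multiplier _ _ _ P G sG g mg g1 (fun t => h t i 0)
  (mh i 0) (integrable_sqr_component i Lh).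
have [iS ES] := integrable_expect_sum (index_enum 'I_p) (fun i => (comp i).1).
have [iS' ES'] := integrable_expect_sum (index_enum 'I_p)
  (fun i => integrable_sqr_component i Lh).
split; first by split; [exact: mx_measurableZ|under eq_fun do rewrite E].
rewrite /ip; under eq_Rintegral do rewrite E.
rewrite ES; under eq_bigr do rewrite (comp _).2.
by rewrite -ES'; apply: eq_Rintegral => t _; apply: eq_bigr => i _; rewrite expr2.
Qed.

Let Z p (X : T -> 'cV[R]_p) := cexpv P G (fun t => g t *: X t).

Let integrable_multiplier (X : T -> R) : measurable_fun setT X -> Int (fun t => X t ^+ 2) ->
  Int (fun t => g t * X t).
Proof. by move=> mX iX; apply: integrable_mul => //; case: g1. Qed.

Let Z_component p (X : T -> 'cV[R]_p) i : L2 X ->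
  is_cexp P G (fun t => g t * X t i 0) (fun t => Z X t i 0).
Proof.
move=> LX; have [mX iX _] := L2_component i LX.
have -> : (fun t => Z X t i 0) = cexp P G (fun t => g t * X t i 0).
  apply/funext => t; rewrite /Z /cexpv mxE; congr (cexp P G _ t).
  by apply/funext => u; rewrite mxE.
by apply: cexpP => //; exact: integrable_multiplier.
Qed.

(** The projection [X |-> E[g X | G]] is the adjoint of the isometry
    [h |-> g h] of [L^2(G)]. *)
Lemma cexpv_adjoint p (X : T -> 'cV[R]_p) : L2 X ->
  [/\ mxG (Z X), L2 (Z X), ip (Z X) (Z X) <= ip X X &
    forall h, mxG h -> L2 h -> ip h (Z X) = ip (fun t => g t *: h t) X].
Proof.
move=> LX; have comp i := Z_component i LX.
have sq i : Int (fun t => Z X t i 0 ^+ 2) /\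
    Ex (fun t => Z X t i 0 ^+ 2) <= Ex (fun t => X t i 0 ^+ 2).
  by have [mX iX _] := L2_component i LX; apply: (cexp_square_le sG mg g1 mX iX).
have mZ : mxG (Z X) by move=> i j; rewrite (ord1 j); case: (comp i).
have [iS ES] := integrable_expect_sum (index_enum 'I_p) (fun i => (sq i).1).
have [iS' ES'] := integrable_expect_sum (index_enum 'I_p)
  (fun i => integrable_sqr_component i LX).
have E (Y : T -> 'cV[R]_p) t : dotv (Y t) (Y t) = \sum_(i < p) Y t i 0 ^+ 2.
  by apply: eq_bigr => i _; rewrite expr2.
have LZ : L2 (Z X).
  by split; [exact: mx_measurable_sub|under eq_fun do rewrite E].
split => //.
  rewrite /ip; under eq_Rintegral do rewrite E.
  under [leRHS]eq_Rintegral do rewrite E.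
  by rewrite ES ES'; apply: ler_sum => i _; case: (sq i).
move=> h mh Lh; have [Lgh _] := L2_unit_multiplier mh Lh.
have iZ i : Int (fun t => h t i 0 * Z X t i 0).
  apply: integrable_mul; by [case: (L2_component i Lh)|case: (L2_component i LZ)].
have iX i : Int (fun t => (g t *: h t) i 0 * X t i 0).
  apply: integrable_mul; by [case: (L2_component i Lgh)|case: (L2_component i LX)].
rewrite /ip (integrable_expect_sum _ iZ).2 (integrable_expect_sum _ iX).2.
apply: eq_bigr => i _; have E' t : (g t *: h t) i 0 * X t i 0 =
  h t i 0 * (g t * X t i 0) by rewrite mxE; ring.
have ihX : Int (fun t => h t i 0 * (g t * X t i 0)).
  by have := iX i; under eq_fun do rewrite E'.
rewrite -(expect_cexpM sG (comp i) (mh i 0) ihX (iZ i)).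
by apply: eq_Rintegral => t _; rewrite E'.
Qed.

(** The defect of linearity is [G]-measurable and orthogonal to [L^2(G)], hence
    orthogonal to itself. *)
Lemma cexpvB p (X Y : T -> 'cV[R]_p) : L2 X -> L2 Y ->
  \forall t \ae P, Z (fun t => X t - Y t) t = Z X t - Z Y t.
Proof.
move=> LX LY; have [mZX LZX _ aX] := cexpv_adjoint LX.
have [mZY LZY _ aY] := cexpv_adjoint LY.
have [mZ LZ _ aZ] := cexpv_adjoint (L2B LX LY).
pose D t := Z (fun t => X t - Y t) t - (Z X t - Z Y t).
have mD : mxG D by apply: mx_measurableB => //; exact: mx_measurableB.
have LD : L2 D by apply: L2B => //; exact: L2B.
have [LgD _] := L2_unit_multiplier mD LD.
suff : \forall t \ae P, D t = 0 by apply: filterS => t /eqP; rewrite subr_eq0 => /eqP.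
apply: nsq_eq0 => //; rewrite {2}/D ipBr ?ipBr ?aZ ?aX ?aY ?ipBr ?subrr//.
exact: L2B.
Qed.

End Cexpv.

End RandomVectors.

(** * Completeness and contractions *)

Lemma geometric_lt (R : realType) (q K e : R) : 0 <= q -> q < 1 -> 0 < e ->
  exists j : nat, K * q ^+ j < e.
Proof.
move=> q0 q1 e0; have : (fun j => K * q ^+ j) @ \oo --> K * 0.
  by apply: cvgMr; apply: cvg_expr; rewrite ger0_norm.
rewrite mulr0 => /(cvgr_lt 0)/(_ e e0)[j _ jP].
by exists j; exact: (jP j (leqnn j)).
Qed.

Section Completeness.
Context {d : measure_display} {T : measurableType d} {R : realType}.
Variable P : probability T R.
Local Notation Int X := (P.-integrable [set: T] (EFin \o X)).
Local Notation Ex X := (Rintegral P [set: T] X).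
Variables (r rho : R).
Hypotheses (r_gt0 : 0 < r) (r_rho : r < rho) (rho_lt1 : rho < 1).

Let rho_gt0 : 0 < rho. Proof. exact: lt_trans r_rho. Qed.

(** Splitting a square with weights [rho] and [1 - rho] costs one factor
    [rho^-1] per step, so increments contribute with weights [rho^(-l)]. *)
Lemma telescope_sqr_le (f : nat -> R) (k j : nat) :
  (f (j + k)%N - f j) ^+ 2 <= rho ^+ j / (1 - rho) *
    \sum_(j <= l < j + k) (rho ^- l * (f l.+1 - f l) ^+ 2).
Proof.
elim: k j => [|k IH] j.
  by rewrite addn0 subrr expr0n big_geq// mulr0.
rewrite big_ltn ?addnS ?ltnS ?leq_addr// -addSn.
set S := \sum_(_ <= l < _) _; have := IH j.+1; rewrite -/S.
set a := f (j.+1 + k)%N - f j.+1; set b := f j.+1 - f j => aS.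
have -> : f (j.+1 + k)%N - f j = a + b by rewrite /a /b; ring.
have rj : rho ^+ j != 0 by rewrite expf_neq0// gt_eqF.
have E : rho ^+ j / (1 - rho) * (rho ^- j * b ^+ 2 + S) =
    b ^+ 2 / (1 - rho) + rho ^+ j.+1 / (1 - rho) * S / rho.
  have r1 : 1 - rho != 0 by rewrite subr_eq0 gt_eqF.
  have r0 : rho != 0 := negbT (gt_eqF rho_gt0).
  by rewrite [rho ^+ j.+1]exprS; move: (rho ^+ j) rj => q q0; field; rewrite q0 r1 r0.
rewrite E; apply: (@le_trans _ _ (b ^+ 2 / (1 - rho) + a ^+ 2 / rho)).
  rewrite -subr_ge0.
  have -> : b ^+ 2 / (1 - rho) + a ^+ 2 / rho - (a + b) ^+ 2 =
    (rho * b - (1 - rho) * a) ^+ 2 / (rho * (1 - rho)).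
    have r1 : 1 - rho != 0 by rewrite subr_eq0 gt_eqF.
    by have r0 : rho != 0 := negbT (gt_eqF rho_gt0); field; rewrite r1 r0.
  by rewrite divr_ge0 ?sqr_ge0// mulr_ge0 ?subr_ge0// ltW.
by rewrite lerD2l ler_pM2r ?invr_gt0.
Qed.

Lemma geometric_partial_sum (q : R) n : 0 <= q -> q < 1 ->
  \sum_(0 <= l < n) q ^+ l <= (1 - q)^-1.
Proof.
move=> q0 q1; rewrite -(@ler_pM2r _ (1 - q)) ?subr_gt0// mulVf ?subr_eq0 ?gt_eqF//.
have -> : (\sum_(0 <= l < n) q ^+ l) * (1 - q) = 1 - q ^+ n.
  elim: n => [|n IH]; first by rewrite big_geq// mul0r expr0 subrr.
  by rewrite big_nat_recr//= mulrDl IH exprS; ring.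
by rewrite gerBl exprn_ge0.
Qed.

Section Scalar.
Variables (G : set (set T)) (sG : G `<=` @measurable d T) (c : R).
Variable f : nat -> T -> R.
Hypotheses (mf : forall j, sub_measurable G (f j))
  (fi : forall j, Int (fun t => (f j.+1 t - f j t) ^+ 2))
  (fc : forall j, Ex (fun t => (f j.+1 t - f j t) ^+ 2) <= c * r ^+ j).

Let S t := (\sum_(0 <= l <oo) (rho ^- l * (f l.+1 t - f l t) ^+ 2)%:E)%E.

Let S_ge0 t : (0 <= S t)%E.
Proof.
apply: nneseries_ge0 => l _ _.
by rewrite lee_fin mulr_ge0 ?sqr_ge0// invr_ge0 exprn_ge0// ltW.
Qed.

Let mterm l : measurable_fun [set: T]
  (fun t => (rho ^- l * (f l.+1 t - f l t) ^+ 2)%:E).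
Proof.
apply/measurable_EFinP; apply: measurable_funM => //.
by apply: measurable_funX; apply: measurable_funB; exact: (sub_measurable_measurable sG).
Qed.

Let mS : measurable_fun setT S.
Proof.
apply: (ge0_emeasurable_sum (P := xpredT)) => // l t _ _.
by rewrite lee_fin mulr_ge0 ?sqr_ge0// invr_ge0 exprn_ge0// ltW.
Qed.

Let C0 := c / (1 - r / rho).

Let q_lt1 : r / rho < 1. Proof. by rewrite ltr_pdivrMr// mul1r. Qed.

Let q_ge0 : 0 <= r / rho. Proof. by rewrite divr_ge0// ltW. Qed.

Let c_ge0 : 0 <= c.
Proof.
have := fc 0; rewrite expr0 mulr1; apply: le_trans.
by apply: expect_ge0 => t; exact: sqr_ge0.
Qed.

Let int_S : (\int[P]_t S t <= C0%:E)%E.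
Proof.
rewrite integral_nneseries//; last first.
  move=> l t _.
  by rewrite lee_fin mulr_ge0 ?sqr_ge0// invr_ge0 exprn_ge0// ltW.
apply: lime_le.
  apply: is_cvg_nneseries => l _ _; apply: integral_ge0 => t _.
  by rewrite lee_fin mulr_ge0 ?sqr_ge0// invr_ge0 exprn_ge0// ltW.
apply: nearW => n.
apply: (@le_trans _ _ (\sum_(0 <= l < n) (c * (r / rho) ^+ l)%:E)%E).
  apply: lee_sum => l _.
  rewrite -EFin_expect; last exact: integrable_scale.
  rewrite RintegralZl// lee_fin.
  apply: (@le_trans _ _ (rho ^- l * (c * r ^+ l))).
    by rewrite ler_wpM2l// invr_ge0 exprn_ge0// ltW.
  by rewrite expr_div_n mulrCA mulrA mulrAC -mulrA.
by rewrite sumEFin lee_fin -big_distrr /= ler_wpM2l// geometric_partial_sum.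
Qed.

Let F t := fine (limn_esup (fun n => (f n t)%:E)).

Let mF : sub_measurable G F.
Proof.
apply: (measurableT_comp (fine_measurable measurableT)).
by apply: measurable_fun_limn_esup => n; apply/measurable_EFinP; exact: mf.
Qed.

Let dist_le t n j : (j <= n)%N -> S t \is a fin_num ->
  (f n t - f j t) ^+ 2 <= rho ^+ j / (1 - rho) * fine (S t).
Proof.
move=> jn Sf; have := telescope_sqr_le (f ^~ t) (n - j) j; rewrite subnKC//.
move=> /le_trans; apply; rewrite ler_wpM2l//.
  by rewrite divr_ge0 ?exprn_ge0 ?subr_ge0// ltW.
rewrite -lee_fin fineK// -sumEFin.
have term0 l : (0 <= (rho ^- l * (f l.+1 t - f l t) ^+ 2)%:E)%E.
  by rewrite lee_fin mulr_ge0 ?sqr_ge0// invr_ge0 exprn_ge0// ltW.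
apply: (@le_trans _ _ (\sum_(0 <= l < n)
    (rho ^- l * (f l.+1 t - f l t) ^+ 2)%:E)%E); last exact: nneseries_lim_ge.
by rewrite [leRHS](big_cat_nat _ jn)//= leeDr// sume_ge0.
Qed.

Let lim_le t : S t \is a fin_num -> forall j,
  (F t - f j t) ^+ 2 <= rho ^+ j / (1 - rho) * fine (S t).
Proof.
move=> Sf; have cf : cvg ((fun n => f n t) @ \oo).
  apply/cauchy_cvgP/cauchy_exP => e e0.
  have [j jP] := @geometric_lt R rho (fine (S t) / (1 - rho)) (e ^+ 2)
    (ltW rho_gt0) rho_lt1 (exprn_gt0 _ e0).
  exists (f j t); exists j => // n /= jn; rewrite /ball /= distrC.
  rewrite -(@ltr_pXn2r _ 2)// ?nnegrE ?ltW// real_normK ?num_real//.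
  apply: le_lt_trans (dist_le jn Sf) _; apply: le_lt_trans jP.
  by rewrite le_eqVlt; apply/orP; left; apply/eqP; ring.
have FE : F t = lim ((fun n => f n t) @ \oo).
  rewrite /F; have /cvg_limn_einf_sup[_ ->] // :
    (fun n => (f n t)%:E) @ \oo --> (lim ((fun n => f n t) @ \oo))%:E.
  by apply/cvg_EFin => //; exact: nearW.
move=> j; apply: (@cvgr_to_le _ \oo _ _ (fun n => (f n t - f j t) ^+ 2)).
  rewrite FE !expr2; apply: cvgM; apply: cvgB => //; exact: cvg_cst.
by exists j => // n /= jn; exact: dist_le.
Qed.

(** The weighted sum [S] of squared increments is integrable, hence finite
    almost surely, and [telescope_sqr_le] bounds all squared distances to the
    [j]-th term by [rho^j S / (1 - rho)]. This one dominating function gives both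
    the convergence and its rate; the upper limit [F] serves as limit because it
    is measurable without any convergence assumption. *)
Lemma square_integrable_geometric_cvg : exists2 F : T -> R, sub_measurable G F &
  forall j, Int (fun t => (F t - f j t) ^+ 2) /\
    Ex (fun t => (F t - f j t) ^+ 2) <= C0 / (1 - rho) * rho ^+ j.
Proof.
exists F => // j; pose K := rho ^+ j / (1 - rho).
have K0 : 0 <= K by rewrite divr_ge0 ?exprn_ge0 ?subr_ge0// ltW.
have iS : P.-integrable setT S.
  apply/integrableP; split => //; apply: (@le_lt_trans _ _ C0%:E); last exact: ltry.
  by under eq_integral do rewrite gee0_abs//.
have mFj : measurable_fun setT (fun t => (F t - f j t) ^+ 2).
  by apply: measurable_funX; apply: measurable_funB; exact: (sub_measurable_measurable sG).
have le : (\int[P]_t ((F t - f j t) ^+ 2)%:E <= (C0 / (1 - rho) * rho ^+ j)%:E)%E.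
  apply: (@le_trans _ _ (\int[P]_t (K%:E * S t))%E).
    apply: ae_ge0_le_integral => //.
    - by move=> t _; rewrite lee_fin sqr_ge0.
    - exact/measurable_EFinP.
    - by move=> t _; rewrite mule_ge0// lee_fin.
    - exact: measurable_funeM.
    - apply: filterS (integrable_ae measurableT iS) => t /(_ I) Sf _.
      by rewrite -(fineK Sf) -EFinM lee_fin; exact: lim_le.
  rewrite ge0_integralZl//.
  apply: (@le_trans _ _ (K%:E * C0%:E)%E); first by rewrite lee_wpmul2l// lee_fin.
  by rewrite -EFinM lee_fin /K le_eqVlt; apply/orP; left; apply/eqP; ring.
have iF : Int (fun t => (F t - f j t) ^+ 2).
  apply: integrable_ge0 => //; first by move=> t; exact: sqr_ge0.
  exact: le_lt_trans le (ltry _).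
by split => //; rewrite -lee_fin EFin_expect.
Qed.

End Scalar.
End Completeness.

Section Contraction.
Context {d : measure_display} {T : measurableType d} {R : realType}.
Variables (P : probability T R) (N m : nat) (G : nat -> set (set T)).
Hypothesis sG : forall k, (k < N)%N -> G k `<=` @measurable d T.
Local Notation L2 := (square_integrable P).
Local Notation Ex X := (Rintegral P [set: T] X).
Implicit Types u v : nat -> T -> 'cV[R]_m.

Definition adapted_L2 u : Prop := forall k, (k < N)%N ->
  @mx_measurable _ (g_sigma_algebraType (G k)) R _ _ (u k) /\ L2 (u k).

Definition dist2 u v : R :=
  \sum_(k < N) ip P (fun t => u k t - v k t) (fun t => u k t - v k t).

Lemma dist2_ge0 u v : 0 <= dist2 u v.
Proof. by apply: sumr_ge0 => k _; exact: nsq_ge0. Qed.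

Lemma dist2C u v : dist2 u v = dist2 v u.
Proof. by apply: eq_bigr => k _; rewrite nsqBC. Qed.

Lemma dist2_triangle u v x : adapted_L2 u -> adapted_L2 v -> adapted_L2 x ->
  dist2 u x <= 2 * (dist2 u v + dist2 v x).
Proof.
move=> au av ax; rewrite -big_split big_distrr; apply: ler_sum => k _ /=.
have [_ Lu] := au k (ltn_ord k); have [_ Lv] := av k (ltn_ord k).
have [_ Lx] := ax k (ltn_ord k).
apply: le_trans (nsqD_le (L2B Lu Lv) (L2B Lv Lx)).
have E t : u k t - x k t = (u k t - v k t) + (v k t - x k t) by rewrite subrKA.
by under eq_fun do rewrite E.
Qed.

Lemma dist2_eq0 u v : adapted_L2 u -> adapted_L2 v -> dist2 u v = 0 ->
  eq_process P N u v.
Proof.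
move=> au av /eqP; rewrite psumr_eq0 => [/allP uv|k _]; last exact: nsq_ge0.
move=> k kN; have := uv (Ordinal kN) (mem_index_enum _).
rewrite /= => /eqP /nsq_eq0 -/(_ (L2B (au k kN).2 (av k kN).2)).
by apply: filterS => t /eqP; rewrite subr_eq0 => /eqP.
Qed.

(** The iterates converge geometrically in each component. As [dist2] only
    separates processes up to null sets, so does the fixed point property. *)
Lemma contraction_fixpoint (Phi : (nat -> T -> 'cV[R]_m) -> nat -> T -> 'cV[R]_m) r :
  (forall u, adapted_L2 u -> adapted_L2 (Phi u)) ->
  0 < r -> r < 1 ->
  (forall u v, adapted_L2 u -> adapted_L2 v ->
    dist2 (Phi u) (Phi v) <= r * dist2 u v) ->
  exists2 u, adapted_L2 u & dist2 (Phi u) u = 0.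
Proof.
move=> Phi_ad r0 r1 Phi_c.
have [v [v0 vS]] : exists v : nat -> nat -> T -> 'cV[R]_m,
    v 0%N = (fun _ _ => 0) /\ forall j, v j.+1 = Phi (v j).
  by exists (fun j => iter j Phi (fun _ _ => 0)).
have v_ad j : adapted_L2 (v j).
  elim: j => [|j IH]; last by rewrite vS; exact: Phi_ad.
  by rewrite v0 => k kN; split; [exact: mx_measurable_cst|exact: L2_0].
pose c := dist2 (v 1%N) (v 0%N).
have v_c j : dist2 (v j.+1) (v j) <= c * r ^+ j.
  elim: j => [|j IH]; first by rewrite expr0 mulr1.
  have := Phi_c _ _ (v_ad j.+1) (v_ad j); rewrite -!vS => /le_trans; apply.
  by rewrite exprS mulrCA ler_pM2l.
pose rho := (r + 1) / 2.
have r_rho : r < rho by rewrite /rho; lra.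
have rho1 : rho < 1 by rewrite /rho; lra.
have rho0 : 0 <= rho by lra.
pose C := c / (1 - r / rho) / (1 - rho).
(* The limit is taken separately in each of the finitely many components. *)
have lim (ki : nat * 'I_m) : exists F : T -> R, (ki.1 < N)%N ->
    sub_measurable (G ki.1) F /\ forall j,
    P.-integrable setT (EFin \o (fun t => (F t - v j ki.1 t ki.2 0) ^+ 2)) /\
    Ex (fun t => (F t - v j ki.1 t ki.2 0) ^+ 2) <= C * rho ^+ j.
  case: ki => k i /=; case: (boolP (k < N)%N) => kN; last by exists (fun=> 0).
  have L2v j : L2 (fun t => v j.+1 k t - v j k t).
    by apply: L2B; [case: (v_ad j.+1 k kN)|case: (v_ad j k kN)].
  have incr j t : (v j.+1 k t - v j k t) i 0 = v j.+1 k t i 0 - v j k t i 0.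
    by rewrite !mxE.
  have iv j : P.-integrable setT
      (EFin \o (fun t => (v j.+1 k t i 0 - v j k t i 0) ^+ 2)).
    by have [_ + _] := L2_component i (L2v j); under eq_fun do rewrite incr.
  have vc j : Ex (fun t => (v j.+1 k t i 0 - v j k t i 0) ^+ 2) <= c * r ^+ j.
    apply: le_trans (v_c j).
    have [_ _] := L2_component i (L2v j); under eq_fun do rewrite incr.
    move=> /le_trans; apply; rewrite /dist2 (bigD1 (Ordinal kN))//= lerDl.
    by apply: sumr_ge0 => l _; exact: nsq_ge0.
  have [F mF FP] := @square_integrable_geometric_cvg _ _ _ P r rho r0 r_rho rho1
    (G k) (sG kN) c (fun j t => v j k t i 0) (fun j => (v_ad j k kN).1 i 0) iv vc.
  by exists F.
have [F FP] := choice lim.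
pose u k t : 'cV[R]_m := \col_i F (k, i) t.
have uE k j (i : 'I_m) t : (u k t - v j k t) i 0 = F (k, i) t - v j k t i 0.
  by rewrite !mxE.
have dotE k j t : dotv (u k t - v j k t) (u k t - v j k t) =
    \sum_(i < m) (F (k, i) t - v j k t i 0) ^+ 2.
  by apply: eq_bigr => i _; rewrite uE expr2.
have mu k : (k < N)%N -> @mx_measurable _ (g_sigma_algebraType (G k)) R _ _ (u k).
  move=> kN i j; rewrite (ord1 j); under eq_fun do rewrite mxE.
  by case: (FP (k, i) kN).
have L2uv k j : (k < N)%N -> L2 (fun t => u k t - v j k t) /\
    ip P (fun t => u k t - v j k t) (fun t => u k t - v j k t) <=
      m%:R * C * rho ^+ j.
  move=> kN; have FPk i := (FP (k, i) kN).2 j.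
  have [iS ES] := integrable_expect_sum (index_enum 'I_m) (fun i => (FPk i).1).
  split.
    split; last by under eq_fun do rewrite dotE.
    apply: (mx_measurable_sub (sG kN)); apply: mx_measurableB; first exact: mu.
    by case: (v_ad j k kN).
  rewrite /ip; under eq_Rintegral do rewrite dotE.
  rewrite ES; apply: (@le_trans _ _ (\sum_(i < m) C * rho ^+ j)).
    by apply: ler_sum => i _; case: (FPk i).
  by rewrite sumr_const card_ord mulr_natl mulrnAl.
have u_ad : adapted_L2 u.
  move=> k kN; split; first exact: mu.
  have [Luv _] := L2uv k 0%N kN; have [_ Lv] := v_ad 0%N k kN.
  by have := L2D Luv Lv; under eq_fun do rewrite subrK.
have u_lim j : dist2 u (v j) <= (m%:R * C *+ N) * rho ^+ j.
  apply: (@le_trans _ _ (\sum_(k < N) m%:R * C * rho ^+ j)).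
    by apply: ler_sum => k _; case: (L2uv k j (ltn_ord k)).
  by move: (m%:R * C) => D; rewrite sumr_const card_ord mulrnAl.
exists u => //; apply/eqP; rewrite eq_le dist2_ge0 andbT leNgt; apply/negP => pos.
have [j] := geometric_lt (4 * (m%:R * C *+ N)) rho0 rho1 pos.
apply/negP; rewrite -leNgt.
apply: le_trans (dist2_triangle (Phi_ad _ u_ad) (v_ad j.+1) u_ad) _.
have h1 := Phi_c _ _ u_ad (v_ad j).
have h2 := u_lim j; have h3 := u_lim j.+1; rewrite dist2C in h3.
have h4 : r * dist2 u (v j) <= dist2 u (v j) by rewrite ler_piMl ?dist2_ge0// ltW.
have h5 : (m%:R * C *+ N) * rho ^+ j.+1 <= (m%:R * C *+ N) * rho ^+ j.
  rewrite exprS ler_wpM2l//; last by rewrite ler_piMl ?exprn_ge0// ltW.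
  rewrite mulrn_wge0// mulr_ge0// /C !divr_ge0 ?dist2_ge0// subr_ge0 ltW//.
  by rewrite ltr_pdivrMr ?mul1r// (lt_trans r0).
rewrite -vS in h1.
move: h1 h2 h3 h4 h5; rewrite -mulrA; move: (_ * rho ^+ j) (_ * rho ^+ j.+1).
move: (dist2 (Phi u) _) (dist2 u (v j)) (dist2 (v j.+1) u) => a b e x y.
by move: (r * b) => z; lra.
Qed.

End Contraction.

(** * The filtration of the noise *)

Section Filtration.
Context {d : measure_display} {T : measurableType d} {R : realType}.
Variables (P : probability T R) (w : nat -> T -> R).

Lemma past_generator k j (B : set R) : (j < k)%N -> measurable B ->
  past w k (w j @^-1` B).
Proof.
move=> jk mB; rewrite /past /g_sigma_preimage; apply: sub_sigma_algebra.
rewrite -(bigcup_mkord k (fun i => preimage_set_system setT (w i) measurable)).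
by exists j => //; exists B => //; rewrite setTI.
Qed.

Lemma past_subset k (C : set (set T)) : sigma_algebra setT C ->
  (forall j B, (j < k)%N -> measurable B -> C (w j @^-1` B)) -> past w k `<=` C.
Proof.
move=> sC wC; apply: smallest_sub => //.
rewrite -(bigcup_mkord k (fun i => preimage_set_system setT (w i) measurable)).
by move=> A [j /= jk [B mB <-]]; rewrite setTI; exact: wC.
Qed.

Lemma sigma_algebra_past k : sigma_algebra setT (past w k).
Proof. exact: smallest_sigma_algebra. Qed.

Lemma past_mono j k : (j <= k)%N -> past w j `<=` <<s past w k >>.
Proof.
move=> jk; apply: subset_trans (@sub_sigma_algebra _ setT (past w k)).
apply: past_subset; first exact: sigma_algebra_past.
by move=> i B ij mB; apply: past_generator => //; exact: leq_trans jk.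
Qed.

Lemma sub_measurable_noise j k : (j < k)%N -> sub_measurable (past w k) (w j).
Proof.
move=> jk _ B mB; rewrite setTI; apply: sub_sigma_algebra.
exact: past_generator.
Qed.

Variables (N : nat) (mds : martingale_difference P w N).

Lemma measurable_noise k : (k < N)%N -> measurable_fun setT (w k).
Proof. by move=> kN; have [[iw _ _ _] _] := mds kN; exact: integrable_measurable iw. Qed.

Lemma past_measurable k : (k <= N)%N -> past w k `<=` @measurable d T.
Proof.
move=> kN; apply: past_subset; first exact: sigma_algebra_measurable.
move=> j B jk mB; rewrite -[X in measurable X]setTI.
by apply: measurable_noise => //; exact: leq_trans kN.
Qed.

(** Lets [y'] be treated as [z'] with the multiplier [1] in place of [w_k]. *)
Lemma is_cexp_one k : is_cexp P (past w k) (fun=> 1 ^+ 2) (fun=> 1).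
Proof.
rewrite expr1n; have i1 : P.-integrable setT (EFin \o (fun=> 1 : R)).
  exact: finite_measure_integrable_cst.
by split => //; exact: measurable_cst.
Qed.

Local Notation L2 := (square_integrable P).
Local Notation mxF k := (@mx_measurable _ (g_sigma_algebraType (past w k)) R _ _).
Local Notation adL2 := (adapted_L2 P).

Lemma mx_measurable_pastW j k p q (A : T -> 'M[R]_(p, q)) : (j <= k)%N ->
  mxF j A -> mxF k A.
Proof. by move=> jk mA i l; apply: (sub_measurableW (past_mono jk)); exact: mA. Qed.

Lemma L2FP K p (h : nat -> T -> 'cV[R]_p) : (K <= N.+1)%N ->
  L2F P w K h <-> adL2 K (past w) h.
Proof.
move=> KN; have mh : adapted w K h -> forall k, (k < K)%N -> mx_measurable (h k).
  move=> ah k kK; apply: (mx_measurable_sub (G := past w k)); last exact: ah.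
  by apply: past_measurable; rewrite -ltnS (leq_trans kK).
split=> [[ah fh] k kK|adh].
  split; first exact: ah.
  split; first exact: mh.
  apply: integrable_ge0; [by apply: measurable_dotv; exact: mh|by move=> t; exact: dotv_ge0|].
  move: fh; rewrite unlock; apply: le_lt_trans.
  apply: ge0_le_integral => //.
  - by move=> t _; rewrite lee_fin dotv_ge0.
  - by apply/measurable_EFinP; apply: measurable_dotv; exact: mh.
  - apply/measurable_EFinP; apply: measurable_sum => i.
    by apply: measurable_dotv; apply: mh.
  - move=> t _; rewrite lee_fin (bigD1 (Ordinal kK))//= lerDl.
    by apply: sumr_ge0 => i _; exact: dotv_ge0.
split; first by move=> k kK; case: (adh k kK).
rewrite unlock.
have [iS _] := integrable_expect_sum (P := P) (index_enum 'I_K)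
  (f := fun (k : 'I_K) t => dotv (h k t) (h k t)) (fun k => (adh k (ltn_ord k)).2.2).
by rewrite -EFin_expect// ltry.
Qed.

Lemma yprimeE p (y : nat -> T -> 'cV[R]_p) k :
  yprime P w y k = cexpv P (past w k) (fun t => 1 *: y k.+1 t).
Proof. by congr (cexpv P _ _); apply/funext => t; rewrite scale1r. Qed.

Lemma yprime_adjoint p (y : nat -> T -> 'cV[R]_p) k : (k < N)%N -> L2 (y k.+1) ->
  [/\ mxF k (yprime P w y k), L2 (yprime P w y k),
   ip P (yprime P w y k) (yprime P w y k) <= ip P (y k.+1) (y k.+1) &
   forall h, mxF k h -> L2 h -> ip P h (yprime P w y k) = ip P h (y k.+1)].
Proof.
move=> kN Ly; rewrite yprimeE.
have [mZ LZ le adj] := cexpv_adjoint (past_measurable (ltnW kN))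
  (measurable_cst (1 : R)) (is_cexp_one k) Ly.
split => // h mh Lh; rewrite adj//.
by apply: eq_Rintegral => t _; rewrite scale1r.
Qed.

Lemma zprime_adjoint p (y : nat -> T -> 'cV[R]_p) k : (k < N)%N -> L2 (y k.+1) ->
  [/\ mxF k (zprime P w y k), L2 (zprime P w y k),
   ip P (zprime P w y k) (zprime P w y k) <= ip P (y k.+1) (y k.+1) &
   forall h, mxF k h -> L2 h ->
     ip P h (zprime P w y k) = ip P (fun t => w k t *: h t) (y k.+1)].
Proof.
move=> kN Ly; exact: (cexpv_adjoint (past_measurable (ltnW kN))
  (measurable_noise kN) (mds kN).2 Ly).
Qed.

Lemma yprimeB p (y1 y2 : nat -> T -> 'cV[R]_p) k : (k < N)%N ->
  L2 (y1 k.+1) -> L2 (y2 k.+1) -> \forall t \ae P,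
  yprime P w (fun k t => y1 k t - y2 k t) k t = yprime P w y1 k t - yprime P w y2 k t.
Proof.
move=> kN L1 L2; have := cexpvB (past_measurable (ltnW kN))
  (measurable_cst (1 : R)) (is_cexp_one k) L1 L2.
by rewrite !yprimeE.
Qed.

Lemma zprimeB p (y1 y2 : nat -> T -> 'cV[R]_p) k : (k < N)%N ->
  L2 (y1 k.+1) -> L2 (y2 k.+1) -> \forall t \ae P,
  zprime P w (fun k t => y1 k t - y2 k t) k t = zprime P w y1 k t - zprime P w y2 k t.
Proof.
move=> kN L1 L2; exact: (cexpvB (past_measurable (ltnW kN))
  (measurable_noise kN) (mds kN).2 L1 L2).
Qed.

Lemma noise_isometry p (h : T -> 'cV[R]_p) k : (k < N)%N -> mxF k h -> L2 h ->
  [/\ mxF k.+1 (fun t => w k t *: h t), L2 (fun t => w k t *: h t) &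
   ip P (fun t => w k t *: h t) (fun t => w k t *: h t) = ip P h h].
Proof.
move=> kN mh Lh; have [Lwh E] := L2_unit_multiplier
  (past_measurable (ltnW kN)) (measurable_noise kN) (mds kN).2 mh Lh.
split => //; apply: mx_measurableZ; first exact: sub_measurable_noise.
by apply: mx_measurable_pastW mh.
Qed.

Definition coefficient k {p q} (A : T -> 'M[R]_(p, q)) : Prop :=
  mxF k A /\ ess_bounded P A.

Lemma coefficientT k p q (A : T -> 'M[R]_(p, q)) :
  coefficient k A -> coefficient k (fun t => (A t)^T).
Proof. by move=> [mA bA]; split; [exact: mx_measurableT|exact: ess_boundedT]. Qed.

Lemma coefficient_mulmx k p q (A : T -> 'M[R]_(p, q)) : (k <= N)%N ->
  coefficient k A -> exists2 K, 0 <= K & forall X, mxF k X -> L2 X ->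
  [/\ mxF k (fun t => A t *m X t), L2 (fun t => A t *m X t) &
    ip P (fun t => A t *m X t) (fun t => A t *m X t) <= K * ip P X X].
Proof.
move=> kN [mA bA].
have [K K0 KP] := L2_mulmx (mx_measurable_sub (past_measurable kN) mA) bA.
exists K => // X mX LX; have [LAX le] := KP X LX.
by split => //; exact: mx_measurableM.
Qed.

Lemma LinfF_coefficient k p q (A : nat -> T -> 'M[R]_(p, q)) : (k < N)%N ->
  LinfF P w N A -> coefficient k (A k).
Proof. by move=> kN [mA [c Ac]]; split; [exact: mA|exists c; exact: Ac]. Qed.

End Filtration.

(** * The state equation and its adjoint *)

(** Bounds found one time step at a time become uniform in time, the quantifier
    over the processes [i] staying inside. *)
Lemma uniform_bound (R : realDomainType) (I : Type) (Q : I -> Prop)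
    (phi : nat -> I -> R) (psi : I -> R) n :
  (forall i, Q i -> 0 <= psi i) ->
  (forall k, (k < n)%N ->
    exists2 K, 0 <= K & forall i, Q i -> phi k i <= K * psi i) ->
  exists2 K, 0 <= K & forall i, Q i -> forall k, (k < n)%N -> phi k i <= K * psi i.
Proof.
move=> psi0; elim: n => [|n IH] phiP; first by exists 0.
have [k kn|K K0 KP] := IH; first by apply: phiP; exact: ltnW.
have [L L0 LP] := phiP n (leqnn _).
exists (K + L); first exact: addr_ge0.
move=> i Qi k; rewrite ltnS leq_eqVlt => /predU1P[->|kn]; rewrite mulrDl.
  by apply: le_trans (LP i Qi) _; rewrite lerDr mulr_ge0// psi0.
by apply: le_trans (KP i Qi k kn) _; rewrite lerDl mulr_ge0// psi0.
Qed.

Lemma psdmx_pdmx (R : realType) n (A : 'M[R]_n) : pdmx A -> psdmx A.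
Proof.
move=> pA u; have [->|u0] := eqVneq u 0; last exact: ltW (pA u u0).
by rewrite mulmx0 dotv0l.
Qed.

Section StateAdjoint.
Context {d : measure_display} {T : measurableType d} {R : realType}.
Variables (P : probability T R) (w : nat -> T -> R) (N : nat).
Context {n m : nat}.
Variable D : blq_data R T n m.
Hypotheses (mds : martingale_difference P w N) (regular_D : blq_regular P w N D).

Local Notation L2 := (square_integrable P).
Local Notation mxF k := (@mx_measurable _ (g_sigma_algebraType (past w k)) R _ _).
Local Notation adL2 K := (adapted_L2 P K (past w)).
Local Notation yp := (yprime P w).
Local Notation zp := (zprime P w).
Local Notation nsq X := (ip P X X).
Local Notation energy v := (\sum_(k < N) nsq (v k)).
Implicit Types (x y : nat -> T -> 'cV[R]_n) (v : nat -> T -> 'cV[R]_m).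

Let cA k : (k < N)%N -> coefficient P w k (dA D k).
Proof. by case: regular_D => -[lA _ _ _] _ kN; exact: LinfF_coefficient lA. Qed.
Let cB k : (k < N)%N -> coefficient P w k (dB D k).
Proof. by case: regular_D => -[_ lB _ _] _ kN; exact: LinfF_coefficient lB. Qed.
Let cC k : (k < N)%N -> coefficient P w k (dC D k).
Proof. by case: regular_D => -[_ _ lC _] _ kN; exact: LinfF_coefficient lC. Qed.
Let cQ k : (k < N)%N -> coefficient P w k (dQ D k).
Proof. by case: regular_D => _ [_ [lQ _] _ _] kN; exact: LinfF_coefficient lQ. Qed.
Let cL k : (k < N)%N -> coefficient P w k (dL D k).
Proof. by case: regular_D => _ [_ _ [lL _] _] kN; exact: LinfF_coefficient lL. Qed.
Let cR k : (k < N)%N -> coefficient P w k (dR D k).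
Proof. by case: regular_D => _ [_ _ _ [lR _]] kN; exact: LinfF_coefficient lR. Qed.
Let cM : coefficient P w 0 (fun=> dM D).
Proof.
split; first exact: mx_measurable_cst.
by exists (mx_norm (dM D)); exact: aeW.
Qed.

(** The state equation without its inhomogeneous terms: it governs the
    difference of two states with the same terminal value. *)
Definition linear_state v y : Prop :=
  [/\ adL2 N.+1 y,
      forall k, (k < N)%N -> \forall t \ae P,
        y k t = dA D k t *m yp y k t + dB D k t *m zp y k t + dC D k t *m v k t &
      \forall t \ae P, y N t = 0].

Definition adjoint_state y x : Prop :=
  [/\ adL2 N.+1 x,
      forall k, (k < N)%N -> \forall t \ae P,
        x k.+1 t = (dA D k t)^T *m x k t - dQ D k t *m yp y k t
          + w k t *: ((dB D k t)^T *m x k t - dL D k t *m zp y k t) &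
      \forall t \ae P, x 0 t = - (dM D *m y 0 t)].

Let L2_yp y k : adL2 N.+1 y -> (k < N)%N -> mxF k (yp y k) /\ L2 (yp y k).
Proof.
by move=> ay kN; have [] := yprime_adjoint mds kN (ay k.+1 kN).2.
Qed.

Let L2_zp y k : adL2 N.+1 y -> (k < N)%N -> mxF k (zp y k) /\ L2 (zp y k).
Proof.
by move=> ay kN; have [] := zprime_adjoint mds kN (ay k.+1 kN).2.
Qed.

Let L2_mul p q k (A : T -> 'M[R]_(p, q)) X : (k <= N)%N -> coefficient P w k A ->
  mxF k X /\ L2 X -> mxF k (fun t => A t *m X t) /\ L2 (fun t => A t *m X t).
Proof.
move=> kN cf [mX LX]; have [K _ KP] := coefficient_mulmx mds kN cf.
by have [] := KP X mX LX.
Qed.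

Let L2_add p k (X Y : T -> 'cV[R]_p) : mxF k X /\ L2 X -> mxF k Y /\ L2 Y ->
  mxF k (fun t => X t + Y t) /\ L2 (fun t => X t + Y t).
Proof. by move=> [? ?] [? ?]; split; [exact: mx_measurableD|exact: L2D]. Qed.

Let L2_sub p k (X Y : T -> 'cV[R]_p) : mxF k X /\ L2 X -> mxF k Y /\ L2 Y ->
  mxF k (fun t => X t - Y t) /\ L2 (fun t => X t - Y t).
Proof. by move=> [? ?] [? ?]; split; [exact: mx_measurableB|exact: L2B]. Qed.

Let mxT k p q (A : T -> 'M[R]_(p, q)) : (k <= N)%N -> mxF k A -> mx_measurable A.
Proof. by move=> kN; apply: mx_measurable_sub; exact: past_measurable mds _ kN. Qed.

Lemma adL2B K p (u v : nat -> T -> 'cV[R]_p) : adL2 K u -> adL2 K v ->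
  adL2 K (fun k t => u k t - v k t).
Proof. by move=> au av k kK; apply: L2_sub; [exact: au|exact: av]. Qed.

Lemma state_exists eta v : L2rv P w N eta -> adL2 N v ->
  exists y, is_state P w N D eta v y.
Proof.
move=> [meta feta] av.
have Leta : mxF N eta /\ L2 eta.
  have me : mxF N eta by move=> i j; rewrite (ord1 j); exact: meta.
  have me' := mxT (leqnn N) me.
  split => //; split => //; apply: integrable_ge0.
  - exact: measurable_dotv.
  - by move=> t; exact: dotv_ge0.
  - by move: feta; rewrite unlock.
have aalpha : adL2 N (dalpha D).
  by case: regular_D => -[_ _ _ la] _; apply/(L2FP mds) => //; exact: leqnSn.
(* Backward in time: [b j] is the state at time [N - j]. *)
pose step j (Y : T -> 'cV[R]_n) t := let k := (N - j.+1)%N in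
  dA D k t *m cexpv P (past w k) Y t
  + dB D k t *m cexpv P (past w k) (fun u => w k u *: Y u) t
  + dC D k t *m v k t + dalpha D k t.
have [b [b0 bS]] : exists b : nat -> T -> 'cV[R]_n,
    b 0%N = eta /\ forall j, b j.+1 = step j (b j).
  by exists (nat_rect (fun=> T -> 'cV[R]_n) eta step).
pose y k := b (N - k)%N.
have yE k : (k < N)%N -> y k = fun t => dA D k t *m yp y k t
    + dB D k t *m zp y k t + dC D k t *m v k t + dalpha D k t.
  move=> kN; rewrite {1}/y -subnSK// bS /step subnSK// subKn; last exact: ltnW.
  by [].
have Ly j : (j <= N)%N -> mxF (N - j) (y (N - j)%N) /\ L2 (y (N - j)%N).
  elim: j => [|j IH] jN; first by rewrite subn0 /y subnn b0.
  have := IH (ltnW jN); rewrite -subnSK//; set k := (N - j.+1)%N => -[_ LY].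
  have kN : (k < N)%N by rewrite ltn_subrL (leq_ltn_trans _ jN).
  have [myp Lyp _ _] := yprime_adjoint mds kN LY.
  have [mzp Lzp _ _] := zprime_adjoint mds kN LY.
  rewrite (yE k kN); apply: L2_add; last exact: aalpha.
  apply: L2_add; last by apply: L2_mul; [exact: ltnW|exact: cC|exact: av].
  by apply: L2_add; apply: L2_mul; [exact: ltnW|exact: cA| |exact: ltnW|exact: cB|].
exists y; split.
- apply/(L2FP mds) => // k kN; have := Ly (N - k)%N (leq_subr _ _).
  by rewrite subKn.
- by move=> k kN; apply: aeW => t; rewrite {1}(yE k kN).
- by apply: aeW => t; rewrite /y subnn b0.
Qed.

Lemma state_sub eta v1 v2 y1 y2 :
  is_state P w N D eta v1 y1 -> is_state P w N D eta v2 y2 ->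
  linear_state (fun k t => v1 k t - v2 k t) (fun k t => y1 k t - y2 k t).
Proof.
move=> [/(L2FP mds _ (leqnn _)) a1 e1 t1] [/(L2FP mds _ (leqnn _)) a2 e2 t2].
split; first exact: adL2B.
- move=> k kN; have By := yprimeB mds kN (a1 k.+1 kN).2 (a2 k.+1 kN).2.
  have Bz := zprimeB mds kN (a1 k.+1 kN).2 (a2 k.+1 kN).2.
  have E1 := e1 k kN; have E2 := e2 k kN.
  apply: filterS3 (filterI E1 E2) By Bz => t [-> ->] -> ->.
  rewrite !mulmxBr opprD addrACA subrr addr0 opprD addrACA; congr (_ + _).
  by rewrite opprD addrACA.
- by apply: filterS2 t1 t2 => t -> ->; rewrite subrr.
Qed.

(** Backward recursion: [y'] and [z'] are not larger than [y_(k+1)] in [L^2]. *)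
Lemma linear_state_le : exists2 K, 0 <= K & forall v y, adL2 N v ->
  linear_state v y -> forall k, (k < N.+1)%N -> nsq (y k) <= K * energy v.
Proof.
pose Q (vy : (nat -> T -> 'cV[R]_m) * (nat -> T -> 'cV[R]_n)) :=
  adL2 N vy.1 /\ linear_state vy.1 vy.2.
have energy_ge0 v : 0 <= energy v by apply: sumr_ge0 => k _; exact: nsq_ge0.
have bound j : (j <= N)%N -> exists2 K, 0 <= K & forall vy, Q vy ->
    nsq (vy.2 (N - j)%N) <= K * energy vy.1.
  elim: j => [|j IH] jN.
    exists 0 => // -[v y] [/= av [ay _ yN]]; rewrite subn0 mul0r.
    have [mY LY] := ay N (leqnn _).
    rewrite (ip_ae LY LY (mx_measurable_cst 0) (mx_measurable_cst 0))//.
    by rewrite /ip; under eq_Rintegral do rewrite dotv0l; rewrite Rintegral_cst// mul0r.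
  have [K0 K00 K0P] := IH (ltnW jN); rewrite -subnSK// in K0P.
  set k := (N - j.+1)%N in K0P *.
  have kN : (k < N)%N by rewrite ltn_subrL (leq_ltn_trans _ jN).
  have [KA KA0 KAP] := coefficient_mulmx mds (ltnW kN) (cA kN).
  have [KB KB0 KBP] := coefficient_mulmx mds (ltnW kN) (cB kN).
  have [KC KC0 KCP] := coefficient_mulmx mds (ltnW kN) (cC kN).
  exists (4 * KA * K0 + 4 * KB * K0 + 2 * KC).
    by rewrite !addr_ge0 ?mulr_ge0.
  move=> [v y] Qvy; have [/= av [ay ye yN]] := Qvy.
  have [myp Lyp leyp _] := yprime_adjoint mds kN (ay k.+1 kN).2.
  have [mzp Lzp lezp _] := zprime_adjoint mds kN (ay k.+1 kN).2.
  have [mv Lv] := av k kN.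
  have [mAy LAy leA] := KAP _ myp Lyp; have [mBz LBz leB] := KBP _ mzp Lzp.
  have [mCv LCv leC] := KCP _ mv Lv.
  have Lrhs := L2D (L2D LAy LBz) LCv.
  have [myk Lyk] := ay k (ltnW kN).
  rewrite (ip_ae Lyk Lyk Lrhs.1 Lrhs.1 (ye k kN) (ye k kN)).
  apply: le_trans (nsqD_le (L2D LAy LBz) LCv) _.
  have h1 := nsqD_le LAy LBz; have h2 := K0P _ Qvy; rewrite /= in h2.
  have h3 : nsq (v k) <= energy v.
    rewrite (bigD1 (Ordinal kN))//= lerDl.
    by apply: sumr_ge0 => i _; exact: nsq_ge0.
  have h4 : KA * nsq (yp y k) <= KA * (K0 * energy v).
    by rewrite ler_wpM2l// (le_trans leyp).
  have h5 : KB * nsq (zp y k) <= KB * (K0 * energy v).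
    by rewrite ler_wpM2l// (le_trans lezp).
  have h6 : KC * nsq (v k) <= KC * energy v by rewrite ler_wpM2l.
  apply: (@le_trans _ _ (2 * (2 * (KA * (K0 * energy v) + KB * (K0 * energy v))
      + KC * energy v))).
    have hAB := lerD (le_trans leA h4) (le_trans leB h5).
    rewrite -(ler_pM2l (ltr0n R 2)) in hAB.
    have h := lerD (le_trans h1 hAB) (le_trans leC h6).
    by rewrite -(ler_pM2l (ltr0n R 2)) in h.
  by move: (energy v) => e; rewrite le_eqVlt; apply/orP; left; apply/eqP; ring.
have [|k kN|K K0 KP] := @uniform_bound R _ Q (fun k vy => nsq (vy.2 k))
  (fun vy => energy vy.1) N.+1.
- by move=> vy _; exact: energy_ge0.
- by have := bound (N - k)%N (leq_subr _ _); rewrite subKn.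
by exists K => // v y av ly; exact: (KP (v, y)).
Qed.

Lemma adjoint_exists y : adL2 N.+1 y -> exists x, adjoint_state y x.
Proof.
move=> ay; pose step k (X : T -> 'cV[R]_n) t :=
  (dA D k t)^T *m X t - dQ D k t *m yp y k t
  + w k t *: ((dB D k t)^T *m X t - dL D k t *m zp y k t).
have [x [x0 xS]] : exists x : nat -> T -> 'cV[R]_n,
    x 0%N = (fun t => - (dM D *m y 0%N t)) /\ forall k, x k.+1 = step k (x k).
  by exists (nat_rect (fun=> T -> 'cV[R]_n) (fun t => - (dM D *m y 0%N t)) step).
exists x; split; last by apply: aeW => t; rewrite x0.
  move=> k; elim: k => [|k IH] kN.
    rewrite x0; have [mMy LMy] := L2_mul (leq0n N) cM (ay 0%N isT).
    by split; [exact: mx_measurableN|exact: L2N].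
  have Lx := IH (ltnW kN); rewrite ltnS in kN.
  have Lb := L2_sub (L2_mul (ltnW kN) (coefficientT (cB kN)) Lx)
    (L2_mul (ltnW kN) (cL kN) (L2_zp ay kN)).
  have [mwb Lwb _] := noise_isometry mds kN Lb.1 Lb.2.
  have [ma La] := L2_sub (L2_mul (ltnW kN) (coefficientT (cA kN)) Lx)
    (L2_mul (ltnW kN) (cQ kN) (L2_yp ay kN)).
  rewrite xS; apply: L2_add; split => //.
  exact: mx_measurable_pastW ma.
by move=> k kN; apply: aeW => t; rewrite xS.
Qed.

Lemma adjoint_sub y1 y2 x1 x2 : adL2 N.+1 y1 -> adL2 N.+1 y2 ->
  adjoint_state y1 x1 -> adjoint_state y2 x2 ->
  adjoint_state (fun k t => y1 k t - y2 k t) (fun k t => x1 k t - x2 k t).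
Proof.
move=> a1 a2 [b1 e1 i1] [b2 e2 i2]; split; first exact: adL2B.
- move=> k kN; have By := yprimeB mds kN (a1 k.+1 kN).2 (a2 k.+1 kN).2.
  have Bz := zprimeB mds kN (a1 k.+1 kN).2 (a2 k.+1 kN).2.
  apply: filterS3 (filterI (e1 k kN) (e2 k kN)) By Bz => t [-> ->] -> ->.
  have swap (a b c e : 'cV[R]_n) : (a - b) - (c - e) = (a - c) - (b - e).
    by rewrite !opprD addrACA.
  rewrite opprD addrACA; congr (_ + _); first by rewrite swap -!mulmxBr.
  by rewrite -scalerBr swap -!mulmxBr.
- by apply: filterS2 i1 i2 => t -> ->; rewrite mulmxBr opprD.
Qed.

Lemma adjoint_le : exists2 K, 0 <= K & forall y x, adL2 N.+1 y ->
  adjoint_state y x -> forall k, (k < N.+1)%N ->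
  nsq (x k) <= K * \sum_(j < N.+1) nsq (y j).
Proof.
pose psi (y : nat -> T -> 'cV[R]_n) := \sum_(j < N.+1) nsq (y j).
pose Q (yx : (nat -> T -> 'cV[R]_n) * (nat -> T -> 'cV[R]_n)) :=
  adL2 N.+1 yx.1 /\ adjoint_state yx.1 yx.2.
have psi_ge0 y : 0 <= psi y by apply: sumr_ge0 => k _; exact: nsq_ge0.
have psi_ge y k : (k < N.+1)%N -> nsq (y k) <= psi y.
  move=> kN; rewrite /psi (bigD1 (Ordinal kN))//= lerDl.
  by apply: sumr_ge0 => i _; exact: nsq_ge0.
have bound k : (k < N.+1)%N -> exists2 K, 0 <= K & forall yx, Q yx ->
    nsq (yx.2 k) <= K * psi yx.1.
  elim: k => [|k IH] kN.
    have [KM KM0 KMP] := coefficient_mulmx mds (leq0n N) cM.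
    exists KM => // -[y x] [/= ay [ax _ x0]].
    have [my Ly] := ay 0%N isT; have [mMy LMy le] := KMP _ my Ly.
    have [_ Lx] := ax 0%N isT; have LNy := L2N LMy.
    rewrite (ip_ae Lx Lx LNy.1 LNy.1 x0 x0) ipNl// ipNr// opprK.
    by apply: le_trans le _; rewrite ler_wpM2l// psi_ge.
  have [K0 K00 K0P] := IH (ltnW kN); rewrite ltnS in kN.
  have [KA KA0 KAP] := coefficient_mulmx mds (ltnW kN) (coefficientT (cA kN)).
  have [KB KB0 KBP] := coefficient_mulmx mds (ltnW kN) (coefficientT (cB kN)).
  have [KQ KQ0 KQP] := coefficient_mulmx mds (ltnW kN) (cQ kN).
  have [KL KL0 KLP] := coefficient_mulmx mds (ltnW kN) (cL kN).
  exists (4 * KA * K0 + 4 * KQ + 4 * KB * K0 + 4 * KL).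
    by rewrite !addr_ge0 ?mulr_ge0.
  move=> [y x] Qyx; have [/= ay [ax xe _]] := Qyx.
  have [myp Lyp leyp _] := yprime_adjoint mds kN (ay k.+1 kN).2.
  have [mzp Lzp lezp _] := zprime_adjoint mds kN (ay k.+1 kN).2.
  have [mx Lx] := ax k (ltnW kN).
  have [mAx LAx leA] := KAP _ mx Lx; have [mBx LBx leB] := KBP _ mx Lx.
  have [mQy LQy leQ] := KQP _ myp Lyp; have [mLz LLz leL] := KLP _ mzp Lzp.
  have La := L2B LAx LQy; have Lb := L2B LBx LLz.
  have mb : mxF k (fun t => (dB D k t)^T *m x k t - dL D k t *m zp y k t).
    exact: mx_measurableB.
  have [mwb Lwb Ewb] := noise_isometry mds kN mb Lb.
  have Lrhs := L2D La Lwb; have [_ LxS] := ax k.+1 kN.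
  rewrite (ip_ae LxS LxS Lrhs.1 Lrhs.1 (xe k kN) (xe k kN)).
  apply: le_trans (nsqD_le La Lwb) _; rewrite Ewb.
  have h1 := nsqB_le LAx LQy; have h2 := nsqB_le LBx LLz.
  have h3 := K0P _ Qyx; rewrite /= in h3; have h4 := psi_ge y k.+1 kN.
  have h5 : KA * nsq (x k) <= KA * (K0 * psi y) by rewrite ler_wpM2l.
  have h6 : KB * nsq (x k) <= KB * (K0 * psi y) by rewrite ler_wpM2l.
  have h7 : KQ * nsq (yp y k) <= KQ * psi y by rewrite ler_wpM2l// (le_trans leyp).
  have h8 : KL * nsq (zp y k) <= KL * psi y by rewrite ler_wpM2l// (le_trans lezp).
  apply: (@le_trans _ _ (2 * (2 * (KA * (K0 * psi y) + KQ * psi y)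
      + 2 * (KB * (K0 * psi y) + KL * psi y)))).
    have hA := lerD (le_trans leA h5) (le_trans leQ h7).
    have hB := lerD (le_trans leB h6) (le_trans leL h8).
    rewrite -(ler_pM2l (ltr0n R 2)) in hA; rewrite -(ler_pM2l (ltr0n R 2)) in hB.
    have h := lerD (le_trans h1 hA) (le_trans h2 hB).
    by rewrite -(ler_pM2l (ltr0n R 2)) in h.
  by move: (psi y) => e; rewrite le_eqVlt; apply/orP; left; apply/eqP; ring.
have [|k kN|K K0 KP] := @uniform_bound R _ Q (fun k yx => nsq (yx.2 k))
  (fun yx => psi yx.1) N.+1.
- by move=> yx _; exact: psi_ge0.
- exact: bound.
by exists K => // y x ay axy; exact: (KP (y, x)).
Qed.


(** * Duality and the gradient of the cost *)

Let ip_trmx p q (A : T -> 'M[R]_(p, q)) X Y :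
  ip P (fun t => (A t)^T *m X t) Y = ip P X (fun t => A t *m Y t).
Proof.
by rewrite ip_mulmxl; apply: eq_Rintegral => t _; rewrite trmxK.
Qed.

(** [E <x_(k+1), y_(k+1)>] is moved to time [k] by the adjointness of [y'] and
    [z'], where [A] and [B] cancel; the sum over [k] telescopes between
    [x_0 = - M y3_0] and [y_N = 0]. *)
Lemma duality v y y3 x : adL2 N v -> linear_state v y -> adL2 N.+1 y3 ->
  adjoint_state y3 x ->
  \sum_(k < N) ip P (fun t => (dC D k t)^T *m x k t) (v k) =
  - (ip P (fun t => dM D *m y3 0%N t) (y 0%N) +
     \sum_(k < N) (ip P (fun t => dQ D k t *m yp y3 k t) (yp y k)
                   + ip P (fun t => dL D k t *m zp y3 k t) (zp y k))).
Proof.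
move=> av [ay ye yN] a3 [ax xe x0].
pose c k := ip P (fun t => (dC D k t)^T *m x k t) (v k) +
  (ip P (fun t => dQ D k t *m yp y3 k t) (yp y k)
   + ip P (fun t => dL D k t *m zp y3 k t) (zp y k)).
have step k : (k < N)%N -> ip P (x k.+1) (y k.+1) = ip P (x k) (y k) - c k.
  move=> kN; have Lx := ax k (ltnW kN); have Ly := ay k (ltnW kN).
  have [_ LxS] := ax k.+1 kN; have [_ LyS] := ay k.+1 kN.
  have Lyp := L2_yp ay kN; have Lzp := L2_zp ay kN.
  have LAx := L2_mul (ltnW kN) (coefficientT (cA kN)) Lx.
  have LBx := L2_mul (ltnW kN) (coefficientT (cB kN)) Lx.
  have LQy := L2_mul (ltnW kN) (cQ kN) (L2_yp a3 kN).
  have LLz := L2_mul (ltnW kN) (cL kN) (L2_zp a3 kN).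
  have [ma La] := L2_sub LAx LQy; have [mb Lb] := L2_sub LBx LLz.
  have [mwb Lwb _] := noise_isometry mds kN mb Lb.
  have Lrhs := L2D La Lwb.
  have [_ _ _ adjy] := yprime_adjoint mds kN LyS.
  have [_ _ _ adjz] := zprime_adjoint mds kN LyS.
  rewrite (ip_ae LxS LyS Lrhs.1 LyS.1 (xe k kN) (aeW _ (fun=> erefl))).
  rewrite (ipDl La Lwb LyS) -(adjy _ ma La) -(adjz _ mb Lb).
  rewrite (ipBl LAx.2 LQy.2 Lyp.2) (ipBl LBx.2 LLz.2 Lzp.2).
  rewrite (ip_trmx (dA D k) (x k)) (ip_trmx (dB D k) (x k)).
  have [_ LAy] := L2_mul (ltnW kN) (cA kN) Lyp.
  have [_ LBz] := L2_mul (ltnW kN) (cB kN) Lzp.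
  have [_ LCv] := L2_mul (ltnW kN) (cC kN) (av k kN).
  have LABC := L2D (L2D LAy LBz) LCv.
  rewrite (ip_ae Lx.2 Ly.2 Lx.2.1 LABC.1 (aeW _ (fun=> erefl)) (ye k kN)).
  rewrite (ipDr (L2D LAy LBz) LCv Lx.2) (ipDr LAy LBz Lx.2) /c.
  rewrite (ip_trmx (dC D k) (x k)).
  have arith (aA bQ aB bL aC : R) :
    aA - bQ + (aB - bL) = aA + aB + aC - (aC + (bQ + bL)) by ring.
  exact: arith.
have sum j : (j <= N)%N -> ip P (x j) (y j) = ip P (x 0%N) (y 0%N) - \sum_(k < j) c k.
  elim: j => [|j IH] jN; first by rewrite big_ord0 subr0.
  by rewrite big_ord_recr (step j jN) (IH (ltnW jN)) (opprD (\sum_(k < j) c k)) addrA.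
have := sum N (leqnn N).
have [_ LxN] := ax N (leqnn _); have [_ LyN] := ay N (leqnn _).
rewrite (ip_ae LxN LyN LxN.1 (mx_measurable_cst 0) (aeW _ (fun=> erefl)) yN).
have -> : ip P (x N) (fun=> 0) = 0.
  rewrite ipC /ip; under eq_Rintegral do rewrite dotv0l.
  by rewrite Rintegral_cst// mul0r.
have [_ Lx0] := ax 0%N isT; have [_ Ly0] := ay 0%N isT.
have [_ LMy] := L2_mul (leq0n N) cM (a3 0%N isT).
rewrite (ip_ae Lx0 Ly0 (L2N LMy).1 Ly0.1 x0 (aeW _ (fun=> erefl))) ipNl//.
by rewrite /c big_split /=; lra.
Qed.

(** Second-order part of the cost, as a bilinear form on pairs (state,
    control). *)
Definition cost_form y1 v1 y2 v2 : R :=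
  ip P (fun t => dM D *m y1 0%N t) (y2 0%N) +
  \sum_(k < N) (ip P (fun t => dQ D k t *m yp y1 k t) (yp y2 k)
                + ip P (fun t => dL D k t *m zp y1 k t) (zp y2 k)
                + ip P (fun t => dR D k t *m v1 k t) (v2 k)).

Definition gradient x v k t := dR D k t *m v k t - (dC D k t)^T *m x k t.

Let L2_gradient x v k : (k < N)%N -> adL2 N v -> adL2 N.+1 x ->
  mxF k (gradient x v k) /\ L2 (gradient x v k).
Proof.
move=> kN av ax; apply: L2_sub.
  by apply: L2_mul; [exact: ltnW|exact: cR|exact: av].
by apply: L2_mul; [exact: ltnW|exact/coefficientT/cC|exact/ax/ltnW].
Qed.

(** By duality, [R v - C^T x] is the gradient of the cost at [v]. *)
Lemma gradient_cost_form v y y3 x3 v3 : adL2 N v -> linear_state v y ->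
  adL2 N v3 -> adL2 N.+1 y3 -> adjoint_state y3 x3 ->
  \sum_(k < N) ip P (gradient x3 v3 k) (v k) = cost_form y3 v3 y v.
Proof.
move=> av ly a3 ay3 adj; have := duality av ly ay3 adj; have [ax3 _ _] := adj.
have -> : \sum_(k < N) ip P (gradient x3 v3 k) (v k) =
    \sum_(k < N) ip P (fun t => dR D k t *m v3 k t) (v k) -
    \sum_(k < N) ip P (fun t => (dC D k t)^T *m x3 k t) (v k).
  rewrite -sumrB; apply: eq_bigr => k _; have kN := ltn_ord k.
  rewrite ipBl//; last by case: (av k kN).
    by case: (L2_mul (ltnW kN) (cR kN) (a3 k kN)).
  by case: (L2_mul (ltnW kN) (coefficientT (cC kN)) (ax3 k (ltnW kN))).
move=> ->; rewrite /cost_form [in RHS]big_split /=; lra.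
Qed.

Lemma gradient_le : exists2 K, 0 <= K & forall v y x, adL2 N v ->
  linear_state v y -> adjoint_state y x ->
  \sum_(k < N) nsq (gradient x v k) <= K * energy v.
Proof.
have energy_ge0 v : 0 <= energy v by apply: sumr_ge0 => k _; exact: nsq_ge0.
have [KY KY0 KYP] := linear_state_le; have [KX KX0 KXP] := adjoint_le.
pose I := ((nat -> T -> 'cV[R]_m) * (nat -> T -> 'cV[R]_n) *
  (nat -> T -> 'cV[R]_n))%type.
pose Q (i : I) := [/\ adL2 N i.1.1, linear_state i.1.1 i.1.2 &
  adjoint_state i.1.2 i.2].
have [|k kN|K K0 KP] := @uniform_bound R I Q
  (fun k i => nsq (gradient i.2 i.1.1 k)) (fun i => energy i.1.1) N.
- by move=> i _; exact: energy_ge0.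
- have [KR KR0 KRP] := coefficient_mulmx mds (ltnW kN) (cR kN).
  have [KC KC0 KCP] := coefficient_mulmx mds (ltnW kN) (coefficientT (cC kN)).
  exists (2 * (KR + KC * (KX * (KY *+ N.+1)))).
    by rewrite mulr_ge0// addr_ge0// !mulr_ge0// mulrn_wge0.
  move=> [[v y] x] [/= av ly adj]; have [ay _ _] := ly; have [ax _ _] := adj.
  have [mv Lv] := av k kN; have [mx Lx] := ax k (ltnW kN).
  have [_ LR leR] := KRP _ mv Lv; have [_ LC leC] := KCP _ mx Lx.
  apply: le_trans (nsqB_le LR LC) _; rewrite -mulrA ler_pM2l// mulrDl lerD//.
    apply: le_trans leR _; rewrite ler_wpM2l// (bigD1 (Ordinal kN))//= lerDl.
    by apply: sumr_ge0 => i _; exact: nsq_ge0.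
  apply: le_trans leC _; rewrite -mulrA ler_wpM2l// -mulrA.
  apply: le_trans (KXP y x ay adj k (ltnW kN)) _; rewrite ler_wpM2l//.
  apply: (@le_trans _ _ (\sum_(j < N.+1) KY * energy v)).
    by apply: ler_sum => j _; exact: (KYP v y av ly j (ltn_ord j)).
  by rewrite sumr_const card_ord mulrnAl.
exists (K *+ N); first by rewrite mulrn_wge0.
move=> v y x av ly adj; apply: (@le_trans _ _ (\sum_(k < N) K * energy v)).
  by apply: ler_sum => k _; exact: (KP (v, y, x) (And3 av ly adj) k (ltn_ord k)).
by rewrite sumr_const card_ord mulrnAl.
Qed.

Variables (delta : R) (delta_gt0 : 0 < delta).
Hypotheses (M_psd : psdmx (dM D))
  (QL_psd : forall t k, (k < N)%N -> psdmx (dQ D k t) /\ psdmx (dL D k t))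
  (R_unif : forall t k, (k < N)%N -> psdmx (dR D k t - delta%:M)).

Let R_coercive t k (u : 'cV[R]_m) : (k < N)%N ->
  delta * dotv u u <= dotv (dR D k t *m u) u.
Proof.
move=> kN; have := R_unif t kN u.
by rewrite mulmxBl dotvBl mul_scalar_mx dotvZl subr_ge0.
Qed.

Lemma cost_form_ge y v : adL2 N v -> delta * energy v <= cost_form y v y v.
Proof.
move=> av; rewrite /cost_form -[leLHS]add0r lerD//.
  by apply: expect_ge0 => t; exact: M_psd.
rewrite big_distrr /=; apply: ler_sum => k _; have kN := ltn_ord k.
rewrite -[leLHS]add0r lerD//.
  by apply: addr_ge0; apply: expect_ge0 => t; case: (QL_psd t kN).
have [mv Lv] := av k kN; have [_ LR] := L2_mul (ltnW kN) (cR kN) (av k kN).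
rewrite /ip -RintegralZl//; last exact: integrable_dotv.
apply: le_expect; [|exact: integrable_dotv|by move=> t; exact: R_coercive].
by apply: integrable_scale; exact: integrable_dotv.
Qed.

Let gradient_sub x1 x2 v1 v2 k t : gradient x1 v1 k t - gradient x2 v2 k t =
  gradient (fun k t => x1 k t - x2 k t) (fun k t => v1 k t - v2 k t) k t.
Proof. by rewrite /gradient !mulmxBr !opprD addrACA. Qed.

(** The gradient is affine in the control, so its increments are the gradient of
    the difference, against which [gradient_cost_form] gives the cost form. *)
Lemma gradient_monotone eta v1 v2 y1 y2 x1 x2 : adL2 N v1 -> adL2 N v2 ->
  is_state P w N D eta v1 y1 -> is_state P w N D eta v2 y2 ->
  adjoint_state y1 x1 -> adjoint_state y2 x2 ->
  delta * dist2 P N v1 v2 <=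
  \sum_(k < N) ip P (fun t => gradient x1 v1 k t - gradient x2 v2 k t)
                    (fun t => v1 k t - v2 k t).
Proof.
move=> a1 a2 s1 s2 d1 d2; have ls := state_sub s1 s2; have [ad _ _] := ls.
have [/(L2FP mds _ (leqnn _)) ay1 _ _] := s1.
have [/(L2FP mds _ (leqnn _)) ay2 _ _] := s2.
have av := adL2B a1 a2.
apply: le_trans (cost_form_ge (fun k t => y1 k t - y2 k t) av) _.
rewrite -(gradient_cost_form av ls av ad (adjoint_sub ay1 ay2 d1 d2)).
by apply: ler_sum => k _; under [leRHS]eq_Rintegral do rewrite gradient_sub.
Qed.

(** A short gradient step [v |-> v - tau (R v - C^T x)] is a contraction, and its
    fixed points are the controls with zero gradient, up to null sets. *)
Lemma stationary_control_exists eta : L2rv P w N eta ->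
  exists v y x, [/\ adL2 N v, is_state P w N D eta v y, adjoint_state y x &
    forall k, (k < N)%N -> \forall t \ae P, gradient x v k t = 0].
Proof.
move=> Leta.
have ex v : exists yx : (nat -> T -> 'cV[R]_n) * (nat -> T -> 'cV[R]_n),
    adL2 N v -> is_state P w N D eta v yx.1 /\ adjoint_state yx.1 yx.2.
  have [av|nav] := pselect (adL2 N v); last by exists (fun _ _ => 0, fun _ _ => 0).
  have [y sy] := state_exists Leta av; have [/(L2FP mds _ (leqnn _)) ay _ _] := sy.
  by have [x adj] := adjoint_exists ay; exists (y, x).
have [sol solP] := choice ex.
pose g v := gradient (sol v).2 v.
have Lg v k : adL2 N v -> (k < N)%N -> mxF k (g v k) /\ L2 (g v k).
  by move=> av kN; have [_ [ax _ _]] := solP v av; exact: L2_gradient.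
have [K K0 KP] := gradient_le.
(* [tau = delta / L] gives the squared ratio [1 - delta^2 / L] as soon as [K <= L];
   the other summands keep it positive. *)
pose L := K + delta ^+ 2 + 1; pose tau := delta / L; pose r := 1 - delta ^+ 2 / L.
have d2 : 0 < delta ^+ 2 by rewrite exprn_gt0.
have L0 : 0 < L by rewrite /L ltr_wpDl// addr_ge0// ltW.
have r0 : 0 < r by rewrite subr_gt0 ltr_pdivrMr// mul1r /L; lra.
have r1 : r < 1 by rewrite /r ltrBlDr ltrDl divr_gt0.
pose Phi v k t := v k t - tau *: g v k t.
have Phi_ad v : adL2 N v -> adL2 N (Phi v).
  move=> av k kN; have [mg LG] := Lg v k av kN.
  by apply: L2_sub; [exact: av|split; [exact: mx_measurableZ|exact: L2Z]].
have Phi_c u v : adL2 N u -> adL2 N v ->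
    dist2 P N (Phi u) (Phi v) <= r * dist2 P N u v.
  move=> au av; have [su du] := solP u au; have [sv dv] := solP v av.
  have mono := gradient_monotone au av su sv du dv.
  have lip : \sum_(k < N) nsq (fun t => g u k t - g v k t) <= K * dist2 P N u v.
    have ls := state_sub su sv; have [/(L2FP mds _ (leqnn _)) ay _ _] := su.
    have [/(L2FP mds _ (leqnn _)) ay' _ _] := sv.
    apply: le_trans (KP _ _ _ (adL2B au av) ls (adjoint_sub ay ay' du dv)).
    by apply: ler_sum => k _; under eq_fun do rewrite /g gradient_sub.
  have -> : dist2 P N (Phi u) (Phi v) = dist2 P N u v
      - 2 * tau * (\sum_(k < N) ip P (fun t => g u k t - g v k t)
                                     (fun t => u k t - v k t))
      + tau ^+ 2 * \sum_(k < N) nsq (fun t => g u k t - g v k t).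
    rewrite !big_distrr /= -sumrB -big_split /=; apply: eq_bigr => k _.
    have kN := ltn_ord k; have [_ LU] := L2_sub (au k kN) (av k kN).
    have [_ LG] := L2_sub (Lg u k au kN) (Lg v k av kN).
    have E t : Phi u k t - Phi v k t =
        (u k t - v k t) - tau *: (g u k t - g v k t).
      rewrite /Phi; move: (u k t) (v k t) (g u k t) (g v k t) => a b e f.
      by rewrite scalerBr !opprD addrACA.
    under eq_fun do rewrite E.
    have LtG := L2Z tau LG.
    rewrite (ipBl LU LtG (L2B LU LtG)) (ipBr LU LtG LU) (ipBr LU LtG LtG).
    rewrite (ipZl _ LG LU) (ipZr _ LG LU) (ipZl _ LG LtG) (ipZr _ LG LG).
    by rewrite (ipC _ (fun t => u k t - v k t)); ring.
  have tau0 : 0 < tau by rewrite divr_gt0.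
  have D0 := dist2_ge0 P N u v.
  apply: (@le_trans _ _ (dist2 P N u v - 2 * tau * (delta * dist2 P N u v)
      + tau ^+ 2 * (L * dist2 P N u v))).
    apply: lerD; first by rewrite lerD2l lerN2 ler_pM2l // mulr_gt0.
    rewrite ler_pM2l ?exprn_gt0//; apply: le_trans lip _.
    by rewrite ler_wpM2r// /L -addrA lerDl addr_ge0// ltW.
  have arith (l e : R) : l != 0 ->
      e - 2 * (delta / l) * (delta * e) + (delta / l) ^+ 2 * (l * e) =
      (1 - delta ^+ 2 / l) * e by move=> l0; field.
  by rewrite /r /tau arith// gt_eqF.
have [v av fixv] := contraction_fixpoint
  (fun k kN => past_measurable mds (ltnW kN)) Phi_ad r0 r1 Phi_c.
have [sv adj] := solP v av; exists v, (sol v).1, (sol v).2; split => // k kN.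
have := dist2_eq0 (Phi_ad v av) av fixv kN; apply: filterS => t /eqP.
rewrite /Phi subr_eq -subr_eq0 opprD addrA subrr sub0r oppr_eq0 scaler_eq0.
by rewrite gt_eqF ?divr_gt0//= => /eqP.
Qed.


(** * Uniqueness and optimality *)

Let dist2_ae K p (u v : nat -> T -> 'cV[R]_p) : adL2 K u -> adL2 K v ->
  eq_process P K u v -> dist2 P K u v = 0.
Proof.
move=> au av uv; apply: big1 => k _; have kK := ltn_ord k.
have [_ LU] := L2_sub (au k kK) (av k kK).
have E : \forall t \ae P, u k t - v k t = 0.
  by apply: filterS (uv k kK) => t ->; rewrite subrr.
rewrite (ip_ae LU LU (mx_measurable_cst 0) (mx_measurable_cst 0) E E).
by rewrite /ip; under eq_Rintegral do rewrite dotv0l; rewrite Rintegral_cst// mul0r.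
Qed.

Let nsqB_eq0 k p (X Y : T -> 'cV[R]_p) : mxF k X /\ L2 X -> mxF k Y /\ L2 Y ->
  nsq (fun t => X t - Y t) <= 0 -> \forall t \ae P, X t = Y t.
Proof.
move=> LX LY le; have [_ LXY] := L2_sub LX LY.
have /(nsq_eq0 LXY) : nsq (fun t => X t - Y t) = 0.
  by apply/eqP; rewrite eq_le le nsq_ge0.
by apply: filterS => t /eqP; rewrite subr_eq0 => /eqP.
Qed.

Lemma state_unique eta v1 v2 y1 y2 : adL2 N v1 -> adL2 N v2 ->
  eq_process P N v1 v2 -> is_state P w N D eta v1 y1 ->
  is_state P w N D eta v2 y2 -> eq_process P N.+1 y1 y2.
Proof.
move=> a1 a2 v12 s1 s2 k kN; have [K K0 KP] := linear_state_le.
have [/(L2FP mds _ (leqnn _)) ay1 _ _] := s1.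
have [/(L2FP mds _ (leqnn _)) ay2 _ _] := s2.
apply: nsqB_eq0 (ay1 k kN) (ay2 k kN) _.
apply: le_trans (KP _ _ (adL2B a1 a2) (state_sub s1 s2) k kN) _.
by have := dist2_ae a1 a2 v12; rewrite /dist2 => ->; rewrite mulr0.
Qed.

Lemma adjoint_unique y1 y2 x1 x2 : adL2 N.+1 y1 -> adL2 N.+1 y2 ->
  eq_process P N.+1 y1 y2 -> adjoint_state y1 x1 -> adjoint_state y2 x2 ->
  eq_process P N.+1 x1 x2.
Proof.
move=> a1 a2 y12 d1 d2 k kN; have [K K0 KP] := adjoint_le.
have [ax1 _ _] := d1; have [ax2 _ _] := d2.
apply: nsqB_eq0 (ax1 k kN) (ax2 k kN) _.
apply: le_trans (KP _ _ (adL2B a1 a2) (adjoint_sub a1 a2 d1 d2) k kN) _.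
by have := dist2_ae a1 a2 y12; rewrite /dist2 => ->; rewrite mulr0.
Qed.

Let R_unit k t : (k < N)%N -> dR D k t \in unitmx.
Proof.
move=> kN; rewrite unitmxE unitfE; apply/negP => /det0P[u u0 uR].
have : delta * dotv u^T u^T <= 0.
  apply: le_trans (R_coercive t u^T kN) _; rewrite dotv_mulmxl.
  by rewrite -trmx_mul uR trmx0 dotvC dotv0l.
rewrite pmulr_rle0// => le0; have /dotv_eq0 : dotv u^T u^T = 0.
  by apply/eqP; rewrite eq_le le0 dotv_ge0.
by move=> /(congr1 trmx); rewrite trmxK trmx0 => /eqP; apply/negP.
Qed.

Definition feedback x k t := invmx (dR D k t) *m (dC D k t)^T *m x k t.

Lemma gradient_feedback x k t : (k < N)%N -> gradient x (feedback x) k t = 0.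
Proof.
move=> kN; rewrite /gradient /feedback -[invmx _ *m _ *m _]mulmxA.
by rewrite mulKVmx ?R_unit// subrr.
Qed.

Lemma gradient_eq0 x v k t : (k < N)%N -> gradient x v k t = 0 ->
  v k t = feedback x k t.
Proof.
move=> kN /eqP; rewrite subr_eq0 => /eqP E.
by rewrite /feedback -[invmx _ *m _ *m _]mulmxA -E mulKmx// R_unit.
Qed.

(** Coercivity of [R] gives [delta `|u| <= `|C^T x|] for [R u = C^T x]; measurability
    comes from the cofactor formula for the inverse. *)
Lemma adL2_feedback x : adL2 N.+1 x -> adL2 N (feedback x).
Proof.
move=> ax k kN; have [mR _] := cR kN; have [mC _] := cC kN.
have [mCx LCx] := L2_mul (ltnW kN) (coefficientT (cC kN)) (ax k (ltnW kN)).
have mu : mxF k (feedback x k).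
  apply: mx_measurableM; last by case: (ax k (ltnW kN)).
  apply: mx_measurableM; last exact: mx_measurableT.
  by apply: mx_measurable_inv => // t; exact: R_unit.
have mu' := mxT (ltnW kN) mu.
split => //; split => //.
apply: (@integrable_le _ _ _ _ _ (fun t => delta ^- 2 *
    dotv ((dC D k t)^T *m x k t) ((dC D k t)^T *m x k t))).
- exact: measurable_dotv.
- move=> t; rewrite ger0_norm ?dotv_ge0// mulrC ler_pdivlMr ?exprn_gt0//.
  set u := feedback x k t; set b := _ *m x k t.
  have Ru : dR D k t *m u = b.
    by have /eqP := gradient_feedback x t kN; rewrite subr_eq0 => /eqP.
  have := R_coercive t u kN; rewrite Ru => le.
  have := dotv_ge0 (b - delta *: u); rewrite dotv_sqB !dotvZr dotvZl => sq.
  have := ler_wpM2l (ltW delta_gt0) le; rewrite -/b; nra.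
- by apply: integrable_scale; case: LCx.
Qed.

Let symmetricT p (A : 'M[R]_p) : A \is symmetricmx -> A^T = A.
Proof.
move=> /is_hermitianmxP E; rewrite [in RHS]E expr0 scale1r.
by apply/matrixP => i j; rewrite !mxE.
Qed.

Lemma quadratic_expansion k p (A : T -> 'M[R]_p) (X1 X2 X : T -> 'cV[R]_p) :
  (k <= N)%N -> coefficient P w k A -> (forall t, (A t)^T = A t) ->
  mxF k X1 /\ L2 X1 -> mxF k X2 /\ L2 X2 -> mxF k X /\ L2 X ->
  (\forall t \ae P, X t = X1 t - X2 t) ->
  ip P (fun t => A t *m X1 t) X1 = ip P (fun t => A t *m X2 t) X2
    + ip P (fun t => A t *m X t) X + 2 * ip P (fun t => A t *m X2 t) X.
Proof.
move=> kN cf symA L1 L2' LX XE.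
have [_ LA1] := L2_mul kN cf L1; have [_ LA2] := L2_mul kN cf L2'.
have [_ LAX] := L2_mul kN cf LX; have [_ LS] := L2_add L2' LX.
have LAS := L2D LA2 LAX.
have E1 : \forall t \ae P, A t *m X1 t = A t *m X2 t + A t *m X t.
  by apply: filterS XE => t ->; rewrite -mulmxDr addrC subrK.
have E2 : \forall t \ae P, X1 t = X2 t + X t.
  by apply: filterS XE => t ->; rewrite addrC subrK.
rewrite (ip_ae LA1 L1.2 LAS.1 LS.1 E1 E2).
rewrite (ipDl LA2 LAX LS) (ipDr L2'.2 LX.2 LA2) (ipDr L2'.2 LX.2 LAX).
have -> : ip P (fun t => A t *m X t) X2 = ip P (fun t => A t *m X2 t) X.
  rewrite (ip_mulmxl P A X X2) ipC; apply: eq_Rintegral => t _.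
  by rewrite symA.
have arith (a b c : R) : a + b + (b + c) = a + c + 2 * b by ring.
exact: arith.
Qed.

(** Second-order Taylor expansion of the quadratic cost. *)
Lemma cost_form_expansion v1 v2 y1 y2 : adL2 N v1 -> adL2 N v2 ->
  adL2 N.+1 y1 -> adL2 N.+1 y2 ->
  cost_form y1 v1 y1 v1 = cost_form y2 v2 y2 v2 +
    cost_form (fun k t => y1 k t - y2 k t) (fun k t => v1 k t - v2 k t)
              (fun k t => y1 k t - y2 k t) (fun k t => v1 k t - v2 k t) +
    2 * cost_form y2 v2 (fun k t => y1 k t - y2 k t) (fun k t => v1 k t - v2 k t).
Proof.
move=> a1 a2 ay1 ay2; have ay := adL2B ay1 ay2; have av := adL2B a1 a2.
have [_ [symM [_ symQ] [_ symL] [_ symR]]] := regular_D.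
have E0 := quadratic_expansion (leq0n N) cM (fun=> symmetricT symM)
  (ay1 0%N isT) (ay2 0%N isT) (ay 0%N isT) (aeW _ (fun=> erefl)).
rewrite /cost_form E0.
set M1 := ip P _ _; set M2 := ip P _ _; set M3 := ip P _ _.
set S1 := \sum_(k < N) _; set S2 := \sum_(k < N) _; set S3 := \sum_(k < N) _.
set S4 := \sum_(k < N) _.
suff -> : S1 = S2 + S3 + 2 * S4 by ring.
rewrite /S1 /S2 /S3 /S4 big_distrr -!big_split /=; apply: eq_bigr => k _.
have kN := ltn_ord k.
have By := yprimeB mds kN (ay1 k.+1 kN).2 (ay2 k.+1 kN).2.
have Bz := zprimeB mds kN (ay1 k.+1 kN).2 (ay2 k.+1 kN).2.
rewrite (quadratic_expansion (ltnW kN) (cQ kN) (fun t => symmetricT (symQ k t kN))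
  (L2_yp ay1 kN) (L2_yp ay2 kN) (L2_yp ay kN) By).
rewrite (quadratic_expansion (ltnW kN) (cL kN) (fun t => symmetricT (symL k t kN))
  (L2_zp ay1 kN) (L2_zp ay2 kN) (L2_zp ay kN) Bz).
rewrite (quadratic_expansion (ltnW kN) (cR kN) (fun t => symmetricT (symR k t kN))
  (a1 k kN) (a2 k kN) (av k kN) (aeW _ (fun=> erefl))).
have arith (q1 q2 q3 l1 l2 l3 r1 r2 r3 : R) :
  q1 + q2 + 2 * q3 + (l1 + l2 + 2 * l3) + (r1 + r2 + 2 * r3) =
  q1 + l1 + r1 + (q2 + l2 + r2) + 2 * (q3 + l3 + r3) by ring.
exact: arith.
Qed.

(** The state appearing in the cost is an arbitrary version, hence the
    existential. *)
Lemma costE eta v : L2rv P w N eta -> adL2 N v ->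
  exists2 y, is_state P w N D eta v y &
  cost P w N D eta v = (2^-1 * cost_form y v y v)%:E.
Proof.
move=> Leta av; have [y0 sy0] := state_exists Leta av.
have sy : is_state P w N D eta v (state P w N D eta v).
  exact: (@xgetPex _ _ [set y | is_state P w N D eta v y] (ex_intro _ y0 sy0)).
exists (state P w N D eta v) => //; rewrite /cost /=.
move: (state P w N D eta v) sy => y [/(L2FP mds _ (leqnn _)) ay _ _].
have iM : P.-integrable setT (EFin \o (fun t => dotv (dM D *m y 0%N t) (y 0%N t))).
  by apply: integrable_dotv; [case: (L2_mul (leq0n N) cM (ay 0%N isT))|case: (ay 0%N isT)].
have iS (k : 'I_N) : P.-integrable setT (EFin \o (fun t =>
    dotv (dQ D k t *m yp y k t) (yp y k t) + dotv (dL D k t *m zp y k t) (zp y k t)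
    + dotv (dR D k t *m v k t) (v k t))) /\
    Rintegral P setT (fun t =>
    dotv (dQ D k t *m yp y k t) (yp y k t) + dotv (dL D k t *m zp y k t) (zp y k t)
    + dotv (dR D k t *m v k t) (v k t)) =
    ip P (fun t => dQ D k t *m yp y k t) (yp y k)
    + ip P (fun t => dL D k t *m zp y k t) (zp y k)
    + ip P (fun t => dR D k t *m v k t) (v k).
  have kN := ltn_ord k.
  have Lyp := L2_yp ay kN; have Lzp := L2_zp ay kN; have Lv := av k kN.
  have [_ LQ] := L2_mul (ltnW kN) (cQ kN) Lyp.
  have [_ LL] := L2_mul (ltnW kN) (cL kN) Lzp.
  have [_ LR] := L2_mul (ltnW kN) (cR kN) Lv.
  have iQ := integrable_dotv LQ Lyp.2; have iL := integrable_dotv LL Lzp.2.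
  have iR := integrable_dotv LR Lv.2.
  split; first by do 2 apply: integrable_add => //.
  by rewrite RintegralD ?RintegralD//; exact: integrable_add.
have [iSS ESS] := integrable_expect_sum (index_enum 'I_N) (fun k => (iS k).1).
rewrite unlock -EFin_expect; last exact: integrable_add.
rewrite -EFinM RintegralD// ESS; congr (_ * (_ + _))%:E.
by apply: eq_bigr => k _; rewrite (iS k).2.
Qed.

(** The first-order term of the expansion is the scalar product with the gradient,
    which vanishes; the second-order term is coercive. *)
Lemma cost_ge_stationary eta v y x u : L2rv P w N eta -> adL2 N v -> adL2 N u ->
  is_state P w N D eta v y -> adjoint_state y x ->
  (forall k, (k < N)%N -> \forall t \ae P, gradient x v k t = 0) ->
  exists2 c : R, cost P w N D eta v = c%:E &
  ((c + 2^-1 * (delta * dist2 P N u v))%:E <= cost P w N D eta u)%E.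
Proof.
move=> Leta av au sy adj grad0.
have [yv sv ->] := costE Leta av; have [yu su ->] := costE Leta au.
exists (2^-1 * cost_form yv v yv v) => //.
have [/(L2FP mds _ (leqnn _)) ay _ _] := sy.
have [/(L2FP mds _ (leqnn _)) ayv _ _] := sv.
have [/(L2FP mds _ (leqnn _)) ayu _ _] := su.
have [xv adjv] := adjoint_exists ayv.
have yvy := state_unique av av (fun k _ => aeW _ (fun=> erefl)) sv sy.
have xvx := adjoint_unique ayv ay yvy adjv adj.
have avu := adL2B au av; have ls := state_sub su sv; have [axv _ _] := adjv.
rewrite lee_fin -mulrDr ler_pM2l ?invr_gt0//.
rewrite (cost_form_expansion au av ayu ayv).
rewrite -(gradient_cost_form avu ls av ayv adjv).
have -> : \sum_(k < N) ip P (gradient xv v k) (fun t => u k t - v k t) = 0.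
  apply: big1 => k _; have kN := ltn_ord k.
  have [_ LG] := L2_gradient kN av axv; have [_ LU] := avu k kN.
  have G0 : \forall t \ae P, gradient xv v k t = 0.
    by apply: filterS2 (grad0 k kN) (xvx k (ltnW kN)) => t; rewrite /gradient => + ->.
  rewrite (ip_ae LG LU (mx_measurable_cst 0) LU.1 G0 (aeW _ (fun=> erefl))).
  by rewrite /ip; under eq_Rintegral do rewrite dotv0l; rewrite Rintegral_cst// mul0r.
by rewrite mulr0 addr0 lerD2l; exact: cost_form_ge.
Qed.

End StateAdjoint.

Theorem theorem4p2 (R : realType) (d : measure_display) (T : measurableType d)
  (P : probability T R) (complete_P : measure_is_complete P)
  (N : nat) (N_gt0 : (0 < N)%N) (n m : nat)
  (w : nat -> T -> R) (mds_w : martingale_difference P w N)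
  (D : blq_data R T n m) (regular_D : blq_regular P w N D)
  (M_pd : pdmx (dM D))
  (QL_psd : forall t k, (k < N)%N -> psdmx (dQ D k t) /\ psdmx (dL D k t))
  (R_unif : exists2 delta : R, 0 < delta &
     forall t k, (k < N)%N -> psdmx (dR D k t - delta%:M))
  (eta : T -> 'cV[R]_n) (eta_L2 : L2rv P w N eta) :
  exists (xb yb : nat -> T -> 'cV[R]_n) (vb : nat -> T -> 'cV[R]_m),
    [/\ L2F P w N.+1 xb,
        L2F P w N.+1 yb,
        hamiltonian_system P w N D eta xb yb vb &
        forall x y v, L2F P w N.+1 x -> L2F P w N.+1 y ->
          hamiltonian_system P w N D eta x y v ->
          eq_process P N.+1 x xb /\ eq_process P N.+1 y yb] /\
    [/\ forall k t, (k < N)%N ->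
          vb k t = invmx (dR D k t) *m (dC D k t)^T *m xb k t,
        optimal_control P w N D eta vb &
        forall u, optimal_control P w N D eta u -> eq_process P N u vb].
Proof.
have [delta delta0 R_coer] := R_unif.
have M_psd := psdmx_pdmx M_pd.
have [v0 [y [x [av0 sy0 adj grad0]]]] :=
  stationary_control_exists mds_w regular_D delta0 M_psd QL_psd R_coer eta_L2.
have [ax xe x0] := adj; have [/(L2FP mds_w _ (leqnn _)) ay ye0 yN] := sy0.
pose v := feedback D x.
have v0v : eq_process P N v0 v.
  move=> k kN; apply: filterS (grad0 k kN) => t.
  exact: (gradient_eq0 delta0 R_coer kN).
have av := adL2_feedback mds_w regular_D delta0 R_coer ax.
have stateW u u' z : eq_process P N u u' -> is_state P w N D eta u z ->
    is_state P w N D eta u' z.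
  move=> uu [az ze zN]; split => // k kN.
  by apply: filterS2 (ze k kN) (uu k kN) => t -> ->.
have sy := stateW _ _ _ v0v sy0.
have gradv k t : (k < N)%N -> gradient D x v k t = 0.
  exact: (gradient_feedback delta0 R_coer).
have grad_ae k (kN : (k < N)%N) : \forall t \ae P, gradient D x v k t = 0.
  by apply: aeW => t; exact: gradv.
exists x, y, v; split; split.
- exact/(L2FP mds_w).
- exact/(L2FP mds_w).
- split => //; first by case: sy.
  move=> k kN; apply: aeW => t; have /eqP := gradv k t kN.
  by rewrite subr_eq0 => /eqP ->; rewrite subrr.
- move=> x' y' v' /(L2FP mds_w _ (leqnn _)) ax' Ly'.
  have /(L2FP mds_w _ (leqnn _)) ay' := Ly'.
  move=> [xe' ye' x0' yN' ve'].
  have av' := adL2_feedback mds_w regular_D delta0 R_coer ax'.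
  have vv' : eq_process P N v' (feedback D x').
    move=> k kN; apply: filterS (ve' k kN) => t /eqP.
    rewrite eq_sym subr_eq0 => /eqP E.
    by apply: (gradient_eq0 delta0 R_coer kN); rewrite /gradient E subrr.
  have sy' : is_state P w N D eta (feedback D x') y'.
    by apply: (stateW v').
  have adj' : adjoint_state P w N D y' x' by [].
  have := gradient_monotone mds_w regular_D M_psd QL_psd R_coer av' av sy' sy adj' adj.
  rewrite big1 => [|k _]; last first.
    rewrite /ip; under eq_Rintegral do
      rewrite (gradient_feedback delta0 R_coer)// gradv// subrr dotv0l.
    by rewrite Rintegral_cst// mul0r.
  rewrite pmulr_rle0// => d0.
  have d00 : dist2 P N (feedback D x') v = 0.
    by apply/eqP; rewrite eq_le d0 dist2_ge0.
  have yy := state_unique mds_w regular_D av' av (dist2_eq0 av' av d00) sy' sy.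
  by split => //; exact: (adjoint_unique mds_w regular_D ay' ay yy adj' adj).
- by move=> k t kN.
- split; first exact/(L2FP mds_w).
  apply/eqP; rewrite eq_le; apply/andP; split.
    apply: le_ereal_inf_tmp => _ [u /(L2FP mds_w _ (leqnSn _)) au <-].
    have [c -> le] := cost_ge_stationary mds_w regular_D M_psd QL_psd R_coer eta_L2
      av au sy adj grad_ae.
    apply: le_trans le; rewrite lee_fin lerDl.
    by rewrite mulr_ge0 ?invr_ge0// mulr_ge0 ?dist2_ge0// ltW.
  by apply: ereal_inf_lbound; exists v => //; exact/(L2FP mds_w).
- move=> u [/(L2FP mds_w _ (leqnSn _)) au uopt].
  have [c cE le] := cost_ge_stationary mds_w regular_D M_psd QL_psd R_coer eta_L2
    av au sy adj grad_ae.
  have : (cost P w N D eta u <= c%:E)%E.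
    rewrite uopt -cE; apply: ereal_inf_lbound; exists v => //.
    exact/(L2FP mds_w).
  move=> /(le_trans le); rewrite lee_fin gerDl pmulr_rle0 ?invr_gt0//.
  rewrite pmulr_rle0// => d0; apply: (dist2_eq0 au av).
  by apply/eqP; rewrite eq_le d0 dist2_ge0.
Qed.
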